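(* A $3$-dimensional polytope $P\subset\mathbb{R}^3$ is equiprojective if and only if, for every edge direction $u$ of $P$, either (i) $C_P(u)=u^\perp$, or (ii) $C_P(u)$ and the relative interior of $-C_P(u)$ form a partition of $u^\perp$ (i.e. they are disjoint and their union is $u^\perp$).
   Context: A $3$-dimensional polytope $P\subset\mathbb{R}^3$ is $k$-equiprojective when its orthogonal projection onto any plane that is not orthogonal to a facet of $P$ is a polygon with exactly $k$ vertices; it is equiprojective if it is $k$-equiprojective for some $k$. For a polytope $P\subset\mathbb{R}^3$ and a face $F$ of $P$, the normal cone is $N_P(F)=\{u\in\mathbb{R}^3:\ u\cdot x\le u\cdot y \text{ for all } x\in P,\ y\in F\}$; normal cones at edges are $2$-dimensional. For a non-zero $u\in\mathbb{R}^3$, the aggregated cone $C_P(u)$ is the union of all $2$-dimensional normal cones of $P$ that are contained in the plane $u^\perp$. A vector $u\in\mathbb{S}^2$ is an edge direction of $P$ when its first non-zero coordinate is positive and some edge of $P$ has its difference of vertices equal to a multiple of $u$. *)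

(* Defs.v *)
From HB Require Import structures.
From mathcomp Require Import all_boot all_order all_algebra.
From mathcomp Require Import boolp classical_sets reals.

Set Implicit Arguments.
Unset Strict Implicit.
Unset Printing Implicit Defensive.

Import Order.TTheory GRing.Theory Num.Theory.
Local Open Scope ring_scope.
Local Open Scope classical_set_scope.

Section Defs.
Variable R : realType.

Notation vec := 'rV[R]_3.

Definition dot (u v : vec) : R := \sum_(i < 3) u 0 i * v 0 i.

Definition perp (u : vec) : set vec := [set w | dot w u = 0].

Definition conv (V : seq vec) : set vec :=
  [set x | exists w : 'I_(size V) -> R,
      (forall i, 0 <= w i) /\ \sum_i w i = 1 /\ x = \sum_i w i *: V`_i].

Definition aff (S : set vec) : set vec :=
  [set x | exists (n : nat) (p : 'I_n -> vec) (w : 'I_n -> R),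
      (forall i, S (p i)) /\ \sum_i w i = 1 /\ x = \sum_i w i *: p i].

Definition dim_ge (S : set vec) (d : nat) : Prop :=
  exists (p0 : vec) (p : 'I_d -> vec),
    S p0 /\ (forall i, S (p i)) /\ row_free (\matrix_(i < d) (p i - p0)).

Definition dim_eq (S : set vec) (d : nat) : Prop :=
  dim_ge S d /\ ~ dim_ge S d.+1.

Definition relint (S : set vec) : set vec :=
  [set x | S x /\ exists eps : R, 0 < eps /\
     forall y, aff S y -> dot (y - x) (y - x) < eps -> S y].

Definition extreme (S : set vec) : set vec :=
  [set x | S x /\ forall y z (t : R), S y -> S z -> 0 < t < 1 ->
      x = t *: y + (1 - t) *: z -> y = z].

Definition card_eq (S : set vec) (k : nat) : Prop :=
  exists s : seq vec, uniq s /\ size s = k /\ forall x, x \in s <-> S x.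

Definition polytope3 (P : set vec) : Prop :=
  (exists V : seq vec, P = conv V) /\ dim_ge P 3.

Definition is_face (P F : set vec) : Prop :=
  exists c : vec, F = [set x | P x /\ forall y, P y -> dot c y <= dot c x].

Definition is_edge (P E : set vec) : Prop := is_face P E /\ dim_eq E 1.
Definition is_facet (P F : set vec) : Prop := is_face P F /\ dim_eq F 2.

Definition ncone (P F : set vec) : set vec :=
  [set u | forall x y, P x -> F y -> dot u x <= dot u y].

Definition agg_cone (P : set vec) (u : vec) : set vec :=
  [set w | exists F, is_face P F /\ dim_eq (ncone P F) 2 /\
                     ncone P F `<=` perp u /\ ncone P F w].

Definition proj (d : vec) (x : vec) : vec := x - (dot x d / dot d d) *: d.

(* the plane d^perp is orthogonal to the facet F: a normal of F lies in d^perp *)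
Definition plane_orth_facet (d : vec) (F : set vec) : Prop :=
  exists n : vec, n != 0 /\ dot n d = 0 /\
    forall x y, F x -> F y -> dot n (x - y) = 0.

Definition k_equiprojective (P : set vec) (k : nat) : Prop :=
  forall d : vec, d != 0 ->
    (forall F, is_facet P F -> ~ plane_orth_facet d F) ->
    card_eq (extreme (proj d @` P)) k.

Definition equiprojective (P : set vec) : Prop :=
  exists k : nat, k_equiprojective P k.

Definition edge_direction (P : set vec) (u : vec) : Prop :=
  dot u u = 1 /\
  (exists i : 'I_3, (forall j : 'I_3, (j < i)%N -> u 0 j = 0) /\ 0 < u 0 i) /\
  exists E a b (t : R), is_edge P E /\ extreme E a /\ extreme E b /\
                        a != b /\ b - a = t *: u.

Definition negset (S : set vec) : set vec := [set x | S (- x)].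

End Defs.

(* Main.v *)
Require Import Defs.
From HB Require Import structures.
From mathcomp Require Import all_boot all_order all_algebra.
From mathcomp Require Import boolp classical_sets reals.
From mathcomp Require Import ring lra zify.

Set Implicit Arguments.
Unset Strict Implicit.
Unset Printing Implicit Defensive.

Import Order.TTheory GRing.Theory Num.Theory.
Local Open Scope ring_scope.
Local Open Scope classical_set_scope.

(** Fix the list [S] of vertices of [P].  For a direction [d] parallel to no
    facet, every vertex of the projected polygon has exactly one successor in
    counterclockwise order, so the number of vertices is the number of ordered
    pairs [(a, b)] of vertices such that [d . ((b - a) x (v - a)) > 0] for all
    other vertices [v]; this condition says that [- d x (b - a)] lies in the
    relative interior of the normal cone of the edge [ab].  The pairs parallel
    to a given [u] therefore contribute [[r in C(u)] + [-r in C(u)]] with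
    [r = d x u].

    Under (i) this contribution is always 2, under (ii) it is always 1, so [P]
    is equiprojective.  Conversely, let [P] be [k]-equiprojective and evaluate
    the count at [u + e x] and [u - e x] for small [e > 0] and generic [x].
    For a pair not parallel to [u] the two indicators add up to a number that
    does not depend on [x]: if the limiting normal [u x (b - a)] is a facet
    normal, then exactly one of them is 1, and otherwise they do not see [x].
    Since the total is [2 k], the contribution of the pairs parallel to [u] is
    constant in [x] as well.  Hence [[r in C(u)] + [-r in C(u)]] is the same for
    all generic [r] in the plane orthogonal to [u]; the value 2 gives (i) and
    the value 1 gives (ii). *)

(** * Coordinates and the cross product *)

Section Vectors.
Variable R : realType.
Notation vec := 'rV[R]_3.
Implicit Types (u v w p q r : vec) (s t : R).

Definition i0 : 'I_3 := Ordinal (isT : (0 < 3)%N).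
Definition i1 : 'I_3 := Ordinal (isT : (1 < 3)%N).
Definition i2 : 'I_3 := Ordinal (isT : (2 < 3)%N).

Lemma dotE u v :
  dot u v = u 0 i0 * v 0 i0 + u 0 i1 * v 0 i1 + u 0 i2 * v 0 i2.
Proof.
rewrite /dot !big_ord_recl big_ord0 addr0 addrA.
have -> : lift ord0 ord0 = i1 :> 'I_3 by apply: val_inj.
have -> : lift ord0 (lift ord0 ord0) = i2 :> 'I_3 by apply: val_inj.
by have -> : ord0 = i0 :> 'I_3 by apply: val_inj.
Qed.

Lemma vecP u v :
  u 0 i0 = v 0 i0 -> u 0 i1 = v 0 i1 -> u 0 i2 = v 0 i2 -> u = v.
Proof.
move=> e0 e1 e2; apply/rowP => -[[|[|[|//]]] hi]; rewrite ?ord1.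
- by rewrite (_ : Ordinal hi = i0) //; apply: val_inj.
- by rewrite (_ : Ordinal hi = i1) //; apply: val_inj.
- by rewrite (_ : Ordinal hi = i2) //; apply: val_inj.
Qed.

Definition cross u v : vec :=
  \row_(i < 3) nth 0 [:: u 0 i1 * v 0 i2 - u 0 i2 * v 0 i1;
                         u 0 i2 * v 0 i0 - u 0 i0 * v 0 i2;
                         u 0 i0 * v 0 i1 - u 0 i1 * v 0 i0] i.

End Vectors.

Ltac coords := rewrite ?dotE; rewrite ?mxE /=; rewrite ?dotE; rewrite ?mxE /=.
Ltac vring := solve [coords; ring | apply: vecP; coords; ring].

(** * Identities for dot and cross products and for orthogonal projection *)

Section VectorLemmas.
Variable R : realType.
Notation vec := 'rV[R]_3.
Implicit Types (u v w p q r d : vec) (s t : R).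

Lemma dotC u v : dot u v = dot v u. Proof. vring. Qed.
Lemma dotDl u v w : dot (u + v) w = dot u w + dot v w. Proof. vring. Qed.
Lemma dotDr u v w : dot w (u + v) = dot w u + dot w v. Proof. vring. Qed.
Lemma dotBl u v w : dot (u - v) w = dot u w - dot v w. Proof. vring. Qed.
Lemma dotBr u v w : dot w (u - v) = dot w u - dot w v. Proof. vring. Qed.
Lemma dotNl u v : dot (- u) v = - dot u v. Proof. vring. Qed.
Lemma dotNr u v : dot u (- v) = - dot u v. Proof. vring. Qed.
Lemma dotZl t u v : dot (t *: u) v = t * dot u v. Proof. vring. Qed.
Lemma dotZr t u v : dot u (t *: v) = t * dot u v. Proof. vring. Qed.
Lemma dot0l u : dot 0 u = 0. Proof. vring. Qed.
Lemma dot0r u : dot u 0 = 0. Proof. vring. Qed.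

Lemma dot_ge0 u : 0 <= dot u u.
Proof. by rewrite dotE -!expr2 !addr_ge0 ?sqr_ge0. Qed.

Lemma dot_eq0 u : dot u u = 0 -> u = 0.
Proof.
rewrite dotE => e; apply: vecP; rewrite !mxE; apply/eqP; rewrite -sqrf_eq0;
  apply/eqP; nra.
Qed.

Lemma dot_gt0 u : u != 0 -> 0 < dot u u.
Proof.
by move=> u0; rewrite lt_def dot_ge0 andbT; apply: contra_neq u0 => /dot_eq0.
Qed.

Lemma cauchy_schwarz u v : dot u v ^+ 2 <= dot u u * dot v v.
Proof.
have := dot_ge0 (cross u v); suff -> :
  dot (cross u v) (cross u v) = dot u u * dot v v - dot u v ^+ 2 by lra.
vring.
Qed.

Lemma crossC u v : cross u v = - cross v u. Proof. vring. Qed.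
Lemma cross_self u : cross u u = 0. Proof. vring. Qed.
Lemma crossZl t u v : cross (t *: u) v = t *: cross u v. Proof. vring. Qed.
Lemma crossZr t u v : cross u (t *: v) = t *: cross u v. Proof. vring. Qed.
Lemma crossDl u v w : cross (u + v) w = cross u w + cross v w. Proof. vring. Qed.
Lemma crossDr u v w : cross u (v + w) = cross u v + cross u w. Proof. vring. Qed.
Lemma crossNl u v : cross (- u) v = - cross u v. Proof. vring. Qed.
Lemma crossNr u v : cross u (- v) = - cross u v. Proof. vring. Qed.
Lemma cross0l u : cross 0 u = 0. Proof. vring. Qed.
Lemma cross0r u : cross u 0 = 0. Proof. vring. Qed.
Lemma dot_cross d p q : dot d (cross p q) = dot (cross d p) q. Proof. vring. Qed.
Lemma dot_crossl p q : dot p (cross p q) = 0. Proof. vring. Qed.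
Lemma dot_crossr p q : dot q (cross p q) = 0. Proof. vring. Qed.
Lemma cross_cross p q r : cross p (cross q r) = dot p r *: q - dot p q *: r.
Proof. vring. Qed.

Lemma cross_eq0 p q : p != 0 -> cross p q = 0 -> exists t, q = t *: p.
Proof.
move=> p0 pq; exists (dot p q / dot p p).
have /eqP : cross p (cross p q) = 0 by rewrite pq cross0r.
rewrite cross_cross subr_eq0 => /eqP e.
by rewrite mulrC -scalerA e scalerA mulVf ?scale1r ?gt_eqF ?dot_gt0.
Qed.

Lemma orth_both n p q : dot n p = 0 -> dot n q = 0 -> cross p q != 0 ->
  exists t, n = t *: cross p q.
Proof.
move=> np nq y0; apply: cross_eq0 => //.
by rewrite crossC cross_cross np nq !scale0r subrr oppr0.
Qed.

Lemma cross_trans u p q :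
  u != 0 -> cross u p = 0 -> cross u q = 0 -> cross p q = 0.
Proof.
move=> u0 /(cross_eq0 u0) [s ->] /(cross_eq0 u0) [t ->].
by rewrite crossZl crossZr cross_self !scaler0.
Qed.

Lemma dot_proj d w x : dot w (proj d x) = dot (proj d w) x.
Proof. by rewrite /proj; coords; ring. Qed.

Lemma dot_proj_self d w : d != 0 -> dot (proj d w) d = 0.
Proof.
by move=> d0; rewrite /proj dotBl dotZl divfK ?subrr ?gt_eqF ?dot_gt0.
Qed.

Lemma dot_proj_perp d w x : dot w d = 0 -> dot w (proj d x) = dot w x.
Proof. by move=> wd; rewrite dot_proj /proj wd mul0r scale0r subr0. Qed.

Lemma projD d x y : proj d (x + y) = proj d x + proj d y.
Proof. by rewrite /proj dotDl mulrDl scalerDl opprD addrACA. Qed.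

Lemma projZ d t x : proj d (t *: x) = t *: proj d x.
Proof. by rewrite /proj dotZl -mulrA scalerBr scalerA. Qed.

Lemma proj_eq d x y : d != 0 -> proj d x = proj d y -> cross d (x - y) = 0.
Proof.
move=> d0 /eqP; rewrite -subr_eq0 /proj => /eqP.
set s := _ / _; set t := _ / _ => e.
have -> : x - y = (s - t) *: d.
  apply/eqP; rewrite -subr_eq0 -e; apply/eqP; vring.
by rewrite crossZr cross_self scaler0.
Qed.

(** * Properties that hold for all sufficiently small positive reals *)

Definition near0 (Q : R -> Prop) :=
  exists2 e0, 0 < e0 & forall e, 0 < e < e0 -> Q e.

Lemma near0_and Q Q' : near0 Q -> near0 Q' -> near0 (fun e => Q e /\ Q' e).
Proof.
move=> [e1 e10 h1] [e2 e20 h2]; exists (Num.min e1 e2).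
  by rewrite lt_min e10.
by move=> e /andP[e0]; rewrite lt_min => /andP[? ?]; split;
  [apply: h1|apply: h2]; rewrite e0.
Qed.

Lemma near0_imp (Q Q' : R -> Prop) :
  (forall e, 0 < e -> Q e -> Q' e) -> near0 Q -> near0 Q'.
Proof.
by move=> h [e0 e00 H]; exists e0 => // e /andP[e1 e2]; apply: (h e e1);
  apply: H; rewrite e1.
Qed.

Lemma near0_all (T : eqType) (s : seq T) (Q : T -> R -> Prop) :
  (forall x, x \in s -> near0 (Q x)) ->
  near0 (fun e => forall x, x \in s -> Q x e).
Proof.
elim: s => [|y s IH] h; first by exists 1.
have [||e0 e00 H] := @near0_and (Q y) (fun e => forall x, x \in s -> Q x e).
- by apply: h; rewrite mem_head.
- by apply: IH => x xs; apply: h; rewrite inE xs orbT.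
- exists e0 => // e /H [Hy Hs] x; rewrite inE => /predU1P[->//|]; exact: Hs.
Qed.

Lemma near0_ex Q : near0 Q -> exists2 e, 0 < e & Q e.
Proof.
move=> [e0 e00 H]; exists (e0 / 2); first by rewrite divr_gt0.
by apply: H; lra.
Qed.

Lemma near0_gt s t : 0 < s -> near0 (fun e => 0 < s + e * t).
Proof.
move=> s0; exists (s / (`|t| + 1)); first by rewrite divr_gt0// ltr_wpDl.
have t1 : 0 < `|t| + 1 by rewrite ltr_wpDl.
move=> e /andP[e0]; rewrite ltr_pdivlMr// => es.
have := ler_norm (- t); rewrite normrN => nt.
suff : - (e * t) <= e * `|t| by lra.
by rewrite -mulrN ler_wpM2l// ltW.
Qed.

Lemma near0_neq s t : (s != 0) || (t != 0) -> near0 (fun e => s + e * t != 0).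
Proof.
have [->/= t0|s0 _] := eqVneq s 0.
  by exists 1 => // e /andP[e0 _]; rewrite add0r mulf_neq0 // gt_eqF.
have [sp|sn] := ltP 0 s.
  by apply: near0_imp (near0_gt t sp) => e _ h; rewrite gt_eqF.
have sn' : 0 < - s by rewrite oppr_gt0 lt_neqAle s0.
apply: near0_imp (near0_gt (- t) sn') => e _ h; rewrite lt_eqF//; lra.
Qed.

Lemma convex_comb_max s s' m t : 0 < t < 1 -> s <= m -> s' <= m ->
  m = t * s + (1 - t) * s' -> s = m /\ s' = m.
Proof.
move=> /andP[t0 t1] sm sm' e.
have h : 0 <= t * (m - s) by rewrite mulr_ge0 ?subr_ge0// ltW.
have h' : 0 <= (1 - t) * (m - s') by rewrite mulr_ge0 ?subr_ge0// ltW.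
have e1 : t * (m - s) = 0 by lra.
have e2 : (1 - t) * (m - s') = 0 by lra.
split; apply/esym/eqP; rewrite -subr_eq0.
  by move/eqP: e1; rewrite mulf_eq0 gt_eqF.
by move/eqP: e2; rewrite mulf_eq0 gt_eqF ?subr_gt0.
Qed.

Lemma seq_argmax (T : eqType) (s : seq T) (f : T -> R) : s != [::] ->
  exists2 x, x \in s & forall y, y \in s -> f y <= f x.
Proof.
elim: s => // a s IH _; have [->|/IH[x xs hx]] := eqVneq s [::].
  by exists a; rewrite ?mem_head// => y; rewrite inE => /eqP ->.
have [le|lt] := leP (f a) (f x).
  exists x; first by rewrite inE xs orbT.
  by move=> y; rewrite inE => /predU1P[->//|/hx].
exists a; rewrite ?mem_head// => y; rewrite inE => /predU1P[->//|/hx h].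
by rewrite (le_trans h)// ltW.
Qed.

End VectorLemmas.

(** * Convex hulls, separation, vertices and dimension *)

Section Convexity.
Variable R : realType.
Notation vec := 'rV[R]_3.
Implicit Types (u v w p q r d : vec) (s t : R) (K : set vec).

Definition cvx K :=
  forall x y t, K x -> K y -> 0 < t < 1 -> K (t *: x + (1 - t) *: y).

Lemma conv_mem (V : seq vec) v : v \in V -> conv V v.
Proof.
move=> vV; have hj : (index v V < size V)%N by rewrite index_mem.
pose j := Ordinal hj; exists (fun i => (i == j)%:R); split=> [i|].
  by rewrite ler0n.
split; rewrite (bigD1 j)//= eqxx big1 ?addr0//.
- by move=> i /negPf->.
- by rewrite scale1r nth_index.
- by move=> i /negPf->; rewrite scale0r.
Qed.

Lemma conv_cvx (V : seq vec) : cvx (conv V).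
Proof.
move=> x y t [w [w0 [w1 ->]]] [z [z0 [z1 ->]]] /andP[t0 t1].
exists (fun i => t * w i + (1 - t) * z i); split=> [i|].
  by rewrite addr_ge0// mulr_ge0// ?subr_ge0 ltW.
split; first by rewrite big_split/= -!mulr_sumr w1 z1; ring.
rewrite !scaler_sumr -big_split/=; apply: eq_bigr => i _.
by rewrite !scalerA -scalerDl.
Qed.

(** The weights are normalised by their sum instead of being assumed to sum to 1, so that the
    induction can pass to the tail. A tail of total weight zero is treated apart. *)
Lemma cvx_comb K n (p : 'I_n -> vec) (w : 'I_n -> R) : cvx K ->
  (forall i, K (p i)) -> (forall i, 0 <= w i) -> 0 < \sum_i w i ->
  K ((\sum_i w i)^-1 *: \sum_i w i *: p i).
Proof.
move=> cK; elim: n p w => [|n IH] p w Kp w0; first by rewrite big_ord0 ltxx.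
rewrite !big_ord_recl.
have IH' := IH (fun i => p (lift ord0 i)) (fun i => w (lift ord0 i))
  (fun i => Kp _) (fun i => w0 _).
have : 0 <= \sum_(i < n) w (lift ord0 i) by apply: sumr_ge0.
rewrite le_eqVlt => /predU1P[/esym e W0|Wp W0].
  have z i : w (lift ord0 i) = 0.
    by move/eqP: e; rewrite psumr_eq0// => /allP/(_ i); rewrite mem_index_enum;
      move=> /(_ isT)/eqP.
  rewrite e addr0 in W0 *; rewrite [X in _ + X]big1 ?addr0; last first.
    by move=> i _; rewrite z scale0r.
  by rewrite scalerA mulVf ?gt_eqF// scale1r.
have [e0|wn0] := eqVneq (w ord0) 0; first by rewrite e0 scale0r !add0r; exact: IH'.
have wp : 0 < w ord0 by rewrite lt_def wn0 w0.
move: {IH'}(IH' Wp) W0; set W := \sum_(_ < _) _; set X := \sum_(_ < _) _ => KX W0.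
have -> : (w ord0 + W)^-1 *: (w ord0 *: p ord0 + X) =
  (w ord0 / (w ord0 + W)) *: p ord0 + (1 - w ord0 / (w ord0 + W)) *: (W^-1 *: X).
  rewrite scalerDr !scalerA [_^-1 * _]mulrC; congr (_ + _ *: _).
  by field; rewrite ?gt_eqF.
apply: cK => //; rewrite divr_gt0//= ltr_pdivrMr// mul1r ltrDl//.
Qed.

Lemma conv_min K (V : seq vec) : cvx K -> (forall v, v \in V -> K v) ->
  conv V `<=` K.
Proof.
move=> cK VK x [w [w0 [w1 ->]]].
have := @cvx_comb K _ (fun i : 'I_(size V) => V`_i) w cK.
by rewrite w1 invr1 scale1r; apply=> // i; apply: VK; rewrite mem_nth.
Qed.

Lemma halfspace_cvx w t : cvx [set x | dot w x <= t].
Proof. by move=> x y s /= xt yt /andP[s0 s1]; rewrite dotDr !dotZr; nra. Qed.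

Lemma dot_conv_le (V : seq vec) w t : (forall v, v \in V -> dot w v <= t) ->
  forall x, conv V x -> dot w x <= t.
Proof. by move=> h x; exact: (conv_min (@halfspace_cvx w t)). Qed.

(* Gordan's alternative.  In the inductive step the vectors of the tail are
   moved along the segments towards the new vector [y] into the hyperplane
   orthogonal to [w], where the induction hypothesis applies again. *)
Lemma gordan (T : seq vec) :
  conv T 0 \/ exists w, forall y, y \in T -> 0 < dot w y.
Proof.
move: {2}(size T) (erefl (size T)) => n; elim: n T => [|n IH] [|y T]//=.
  by right; exists 0.
case=> sT; have subT : conv T `<=` conv (y :: T).
  apply: conv_min; first exact: conv_cvx.
  by move=> v vT; apply: conv_mem; rewrite inE vT orbT.
have [/subT|[w hw]] := IH T sT; first by left.
have [wy|] := ltP 0 (dot w y).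
  by right; exists w => x; rewrite inE => /predU1P[->//|]; exact: hw.
have [->|yn0] := eqVneq y 0; first by left; apply: conv_mem; rewrite mem_head.
rewrite le_eqVlt => /predU1P[wy|wy].
  right; have [e e0 he] : exists2 e, 0 < e &
      forall x, x \in T -> 0 < dot w x + e * dot y x.
    by apply: near0_ex; apply: near0_all => x xT; apply/near0_gt/hw.
  exists (w + e *: y) => x; rewrite inE dotDl dotZl => /predU1P[->|]; last exact: he.
  by rewrite wy add0r mulr_gt0// dot_gt0.
pose f x := (- dot w y / (dot w x - dot w y)) *: x
            + (1 - (- dot w y / (dot w x - dot w y))) *: y.
have [c|[z hz]] := IH [seq f x | x <- T] (etrans (size_map _ _) sT).
  left; apply: conv_min c; first exact: conv_cvx.
  move=> _ /mapP[x xT ->]; have wx := hw x xT; apply: conv_cvx.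
  - by apply/subT/conv_mem.
  - by apply: conv_mem; rewrite mem_head.
  - rewrite divr_gt0 ?ltr_pdivrMr; lra.
right; pose z' := z - (dot z y / dot w y) *: w.
have z'y : dot z' y = 0 by rewrite /z' dotBl dotZl divfK ?subrr// lt_eqF.
have z'x x : x \in T -> 0 < dot z' x.
  move=> xT; have wx := hw x xT; have := hz _ (map_f f xT).
  have D : 0 < dot w x - dot w y by lra.
  suff -> : dot z (f x) = (- dot w y / (dot w x - dot w y)) * dot z' x.
    by rewrite pmulr_rgt0// divr_gt0//; lra.
  rewrite /z' /f dotBl dotDr !dotZr dotZl; field.
  by rewrite lt_eqF//= gt_eqF.
have [e e0 he] : exists2 e, 0 < e &
    forall x, x \in T -> 0 < dot z' x + e * - dot w x.
  by apply: near0_ex; apply: near0_all => x xT; apply/near0_gt/z'x.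
exists (z' - e *: w) => x; rewrite inE dotBl dotZl => /predU1P[->|xT].
  by rewrite z'y; nra.
by have := he x xT; rewrite mulrN.
Qed.

(** Gordan's alternative for the differences [q - x]: if 0 is a convex combination of them, then [q]
    is one of the points [x]; otherwise some [w] is positive on all of them. *)
Lemma separation (T : seq vec) q :
  conv T q \/ exists w, forall x, x \in T -> dot w x < dot w q.
Proof.
have [c|[w hw]] := gordan [seq q - x | x <- T].
  left; suff : [set z | conv T (q - z)] 0 by rewrite /= subr0.
  apply: conv_min c.
    move=> x y t /= Kx Ky t01.
    have -> : q - (t *: x + (1 - t) *: y) = t *: (q - x) + (1 - t) *: (q - y).
      vring.
    exact: conv_cvx.
  by move=> _ /mapP[x xT ->] /=; rewrite subKr; exact: conv_mem.
right; exists w => x xT; have := hw _ (map_f _ xT).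
by rewrite dotBr subr_gt0.
Qed.

(** Without repetitions, such a list is the vertex set of its hull: each member is the unique
    maximiser of some functional. *)
Definition all_exposed (S : seq vec) := forall a, a \in S ->
  exists w, forall x, x \in S -> x != a -> dot w x < dot w a.

(** By [separation], a point that is not exposed lies in the hull of the others and can be discarded
    without changing the hull. *)
Lemma vertex_list (V : seq vec) :
  exists S, [/\ uniq S, conv V = conv S & all_exposed S].
Proof.
move: {2}(size V) (leqnn (size V)) => n; elim: n V => [|n IH] V sV.
  exists V; case: V sV => //= _; by split.
have [h|] := pselect (all_exposed V).
  exists (undup V); split; first exact: undup_uniq.
    apply/seteqP; split; apply: conv_min; try exact: conv_cvx.
      by move=> v vV; apply: conv_mem; rewrite mem_undup.
    by move=> v; rewrite mem_undup => vV; apply: conv_mem.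
  move=> a; rewrite mem_undup => /h[w hw]; exists w => x.
  by rewrite mem_undup; exact: hw.
move=> /existsNP[a /not_implyP[aV na]].
(* All copies of [a] are removed, since [V] may contain repetitions. *)
pose T := [seq x <- V | x != a].
have [ca|[w hw]] := separation T a; last first.
  by exfalso; apply: na; exists w => x xV xa; apply: hw; rewrite mem_filter xa.
have [|S [uS cS eS]] := IH T.
  rewrite -ltnS (leq_trans _ sV)// size_filter -(count_predC (pred1 a) V).
  by rewrite -[X in (X < _)%N]add0n ltn_add2r -has_count has_pred1.
exists S; split=> //; rewrite -cS; apply/seteqP.
split; apply: conv_min; try exact: conv_cvx.
  move=> v vV; have [->//|va] := eqVneq v a.
  by apply: conv_mem; rewrite mem_filter va.
by move=> v; rewrite mem_filter => /andP[_ vV]; exact: conv_mem.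
Qed.

(** The disjunction assumed for the points of [S] defines a convex set, so it passes to the hull. *)
Lemma conv_face (S : seq vec) w t K : cvx K ->
  (forall x, x \in S -> dot w x < t \/ (dot w x = t /\ K x)) ->
  forall x, conv S x -> dot w x <= t /\ (dot w x = t -> K x).
Proof.
move=> cK h x Sx; suff : dot w x < t \/ (dot w x = t /\ K x).
  by case=> [lt|[-> kx]]; split=> //; [exact: ltW|move=> e; move: lt; rewrite e ltxx].
move: x Sx; apply: (@conv_min [set x | dot w x < t \/ (dot w x = t /\ K x)]) => //.
move=> x y s /= hx hy s01; have /andP[s0 s1] := s01; rewrite dotDr !dotZr.
case: hx hy => [hx|[hx kx]] [hy|[hy ky]]; try by left; nra.
by right; split; [rewrite hx hy; ring|exact: cK].
Qed.

Lemma set1_cvx a : cvx [set x | x = a].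
Proof. by move=> x y t /= -> -> _; rewrite -scalerDl addrC subrK scale1r. Qed.

Lemma line_cvx a l : cvx [set x | cross l (x - a) = 0].
Proof.
move=> x y t /= hx hy _.
have -> : cross l (t *: x + (1 - t) *: y - a)
  = t *: cross l (x - a) + (1 - t) *: cross l (y - a) by vring.
by rewrite hx hy !scaler0 addr0.
Qed.

Lemma plane_cvx w t : cvx [set x | dot w x = t].
Proof. by move=> x y s /= hx hy _; rewrite dotDr !dotZr hx hy; ring. Qed.

Lemma dim_ge3_nonplanar (X : set vec) n t : dim_ge X 3 -> n != 0 ->
  ~ (forall x, X x -> dot n x = t).
Proof.
move=> [p0 [p [X0 [Xp fr]]]] n0 h; move/eqP: n0; apply.
apply: (can_inj trmxK); rewrite trmx0.
have uM : (\matrix_i (p i - p0))%R \in unitmx by rewrite -row_free_unit.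
rewrite -[n^T](mulKmx uM).
suff -> : \matrix_i (p i - p0) *m n^T = 0 by rewrite mulmx0.
apply/matrixP => i j; rewrite [j]ord1 !mxE.
transitivity (dot (p i - p0) n); last by rewrite dotC dotBr !h ?subrr.
by apply: eq_bigr => k _; rewrite !mxE.
Qed.

Lemma dim_ge2I (X : set vec) a b v : X a -> X b -> X v ->
  cross (b - a) (v - a) != 0 -> dim_ge X 2.
Proof.
move=> Xa Xb Xv y0; exists a, (fun i : 'I_2 => if i == ord0 then b else v).
split=> //; split=> [i|]; first by case: ifP.
apply: inj_row_free => z; rewrite mulmx_sum_row !big_ord_recl big_ord0 addr0.
rewrite !rowK /=; set s := z _ _; set t := z _ _ => e.
have es : s = 0.
  have : cross (s *: (b - a) + t *: (v - a)) (v - a) = 0 by rewrite e cross0l.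
  rewrite crossDl !crossZl cross_self scaler0 addr0 => /eqP.
  by rewrite scaler_eq0 (negPf y0) orbF => /eqP.
have et : t = 0.
  have : cross (b - a) (s *: (b - a) + t *: (v - a)) = 0 by rewrite e cross0r.
  rewrite crossDr !crossZr cross_self scaler0 add0r => /eqP.
  by rewrite scaler_eq0 (negPf y0) orbF => /eqP.
apply/rowP => i; rewrite mxE; case: (unliftP ord0 i) => [j ->|->//].
by rewrite [j]ord1; exact: et.
Qed.

Lemma dim_ge2E (X : set vec) : dim_ge X 2 ->
  exists a b v, [/\ X a, X b, X v & cross (b - a) (v - a) != 0].
Proof.
move=> [p0 [p [X0 [Xp fr]]]]; exists p0, (p ord0), (p (lift ord0 ord0)).
split=> //; apply/eqP => y0.
have K (z : 'rV[R]_2) : z *m \matrix_(i < 2) (p i - p0) = 0 -> z = 0.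
  by move=> /eqP; rewrite mulmx_free_eq0// => /eqP.
have E z : z *m \matrix_(i < 2) (p i - p0) =
    z 0 ord0 *: (p ord0 - p0) + z 0 (lift ord0 ord0) *: (p (lift ord0 ord0) - p0).
  by rewrite mulmx_sum_row !big_ord_recl big_ord0 addr0 !rowK.
have [e|n0] := eqVneq (p ord0 - p0) 0.
  have /K/rowP/(_ ord0) :
      (delta_mx 0 ord0 : 'rV[R]_2) *m \matrix_(i < 2) (p i - p0) = 0.
    by rewrite E !mxE !eqxx /= e scaler0 scale0r addr0.
  by rewrite !mxE !eqxx => /eqP; rewrite oner_eq0.
have [t et] := cross_eq0 n0 y0.
have /K/rowP/(_ (lift ord0 ord0)) : (\row_i if i == ord0 then t else -1) *m
    \matrix_(i < 2) (p i - p0) = 0.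
  by rewrite E !mxE /= et scaleN1r subrr.
by rewrite !mxE /= => /eqP; rewrite oppr_eq0 oner_eq0.
Qed.

Lemma dim_ge1I (X : set vec) a b : X a -> X b -> a != b -> dim_ge X 1.
Proof.
move=> Xa Xb ab; exists a, (fun=> b); split=> //; split=> //.
apply: inj_row_free => z; rewrite mulmx_sum_row big_ord1 rowK => /eqP.
rewrite scaler_eq0 subr_eq0 [b == a]eq_sym (negPf ab) orbF => /eqP z0.
by apply/rowP => i; rewrite ord1 z0 mxE.
Qed.

End Convexity.

(** * Supporting functionals, facets and silhouettes *)

Section Polytope.
Variable R : realType.
Notation vec := 'rV[R]_3.
Implicit Types (a b c d l m n p q u v w x y : vec) (s t : R).

Lemma ex_perp l : exists2 n, n != 0 & dot n l = 0.
Proof.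
pose e i : vec := delta_mx 0 i.
have en i : e i != 0.
  by apply/eqP => /rowP/(_ i); rewrite !mxE !eqxx => /eqP; rewrite oner_eq0.
have [/eqP h|h] := boolP (cross l (e i2) == 0).
  exists (e i0) => //; have /rowP/(_ i1) := h; rewrite dotE !mxE /=; lra.
by exists (cross l (e i2)) => //; rewrite dotC dot_crossl.
Qed.

Lemma card_eq_uniq (X : set vec) k k' : card_eq X k -> card_eq X k' -> k = k'.
Proof.
move=> [s [us [<- hs]]] [s' [us' [<- hs']]].
apply/eqP; rewrite -uniq_size_uniq//.
by move=> x; apply/idP/idP => [/hs'/hs|/hs/hs'].
Qed.

Variable S : seq vec.
Hypothesis uS : uniq S.
Hypothesis eS : all_exposed S.
Hypothesis nS : forall n t, n != 0 -> exists2 x, x \in S & dot n x != t.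

Notation P := (conv S).

Definition generic d := forall F, is_facet P F -> ~ plane_orth_facet d F.

(** For vertices [a] and [b] this says that [ab] is an edge with [m] in the relative interior of its
    normal cone. It is boolean so that pairs can be counted. *)
Definition edge_at m a b := [&& a != b, dot m b == dot m a &
  all (fun x => [|| x == a, x == b | dot m x < dot m a]) S].

(* [edge_at (- cross d (b - a)) a b], oriented: seen along [d], the projection
   of [P] lies to the left of the line from [a] to [b]. *)
Definition sedge d a b := (a != b) && all (fun x =>
  [|| x == a, x == b | 0 < dot d (cross (b - a) (x - a))]) S.

(** The functional [w] lives on the plane of projection and exposes the image of [a] there, with no
    other member of [S] over that image. *)
Definition silh d a :=
  exists w, dot w d = 0 /\ forall x, x \in S -> x != a -> dot w x < dot w a.

(** Of three distinct collinear points, one lies between the other two and cannot be exposed; the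
    position of [t] relative to 0 and 1 tells which. *)
Lemma noncollinear a b v : a \in S -> b \in S -> v \in S ->
  a != b -> v != a -> v != b -> cross (b - a) (v - a) != 0.
Proof.
move=> aS bS vS ab va vb; apply/eqP => h.
have ba0 : b - a != 0 by rewrite subr_eq0 eq_sym.
have [t et] := cross_eq0 ba0 h.
have E w : dot w v - dot w a = t * (dot w b - dot w a).
  by rewrite -!dotBr et dotZr.
have [t0|t0|t0] := ltgtP t 0.
- have [w hw] := eS aS; have := hw b bS; rewrite eq_sym ab => /(_ isT).
  by have := hw v vS va; have := E w; nra.
- have [t1|t1|t1] := ltgtP t 1.
  + have [w hw] := eS vS; have := hw a aS; rewrite eq_sym va => /(_ isT).
    by have := hw b bS; rewrite eq_sym vb => /(_ isT); have := E w; nra.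
  + have [w hw] := eS bS; have := hw a aS ab; have := hw v vS vb.
    by have := E w; nra.
  + by move/eqP: vb; apply; move: et; rewrite t1 scale1r => /addIr.
- by move/eqP: va; apply; apply/eqP; rewrite -subr_eq0 et t0 scale0r.
Qed.

Lemma third_vertex a b : exists2 x, x \in S & (x != a) && (x != b).
Proof.
have [n n0 nl] := ex_perp (b - a); have [x xS hx] := nS (dot n a) n0.
exists x => //; apply/andP; split; apply: contra_neq hx => ->//.
by move: nl; rewrite dotBr; lra.
Qed.

Lemma support c : exists2 a, a \in S & forall x, x \in S -> dot c x <= dot c a.
Proof.
have [x xS _] := third_vertex 0 0.
by apply: seq_argmax; apply: contraTneq xS => ->.
Qed.

Definition face c := [set x | P x /\ forall y, P y -> dot c y <= dot c x].

Lemma faceP c a : a \in S -> (forall x, x \in S -> dot c x <= dot c a) ->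
  forall x, face c x <-> P x /\ dot c x = dot c a.
Proof.
move=> aS ha x; have Pa := conv_mem aS; split=> -[Px h].
  by split=> //; apply/eqP; rewrite eq_le h// (dot_conv_le ha).
by split=> // y; rewrite h; exact: dot_conv_le.
Qed.

(** The face of [n] contains three non-collinear points and lies in a plane, so it is a facet; its
    normal [n] is orthogonal to [d], against genericity. *)
Lemma generic_facet d n a b v : generic d -> n != 0 -> dot n d = 0 ->
  a \in S -> b \in S -> v \in S -> a != b -> v != a -> v != b ->
  (forall x, x \in S -> dot n x <= dot n a) ->
  dot n b = dot n a -> dot n v = dot n a -> False.
Proof.
move=> gd n0 nd aS bS vS ab va vb hn nb nv.
have fP := faceP aS hn.
apply: (gd (face n)); last first.
  exists n; split=> //; split=> // x y /fP[_ hx] /fP[_ hy].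
  by rewrite dotBr hx hy subrr.
split; first by exists n.
split; first by apply: (@dim_ge2I _ _ a b v); rewrite ?noncollinear//;
  apply/fP; split=> //; exact: conv_mem.
move=> h3; apply: (dim_ge3_nonplanar (t := dot n a) h3 n0).
by move=> x /fP[].
Qed.

Lemma edge_atP m a b : edge_at m a b ->
  [/\ a != b, dot m b = dot m a,
    forall x, x \in S -> x != a -> x != b -> dot m x < dot m a &
    forall x, x \in S -> dot m x <= dot m a].
Proof.
move=> /and3P[ab /eqP mb /allP h].
have h' x : x \in S -> x != a -> x != b -> dot m x < dot m a.
  by move=> xS /negPf xa /negPf xb; have := h x xS; rewrite xa xb.
split=> // x xS; have [->//|xa] := eqVneq x a.
by have [->|xb] := eqVneq x b; rewrite ?mb// ltW ?h'.
Qed.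

Lemma edge_atI m a b : a != b -> dot m b = dot m a ->
  (forall x, x \in S -> x != a -> x != b -> dot m x < dot m a) ->
  edge_at m a b.
Proof.
move=> ab mb h; rewrite /edge_at ab mb eqxx; apply/allP => x xS.
by have [//|xa] := eqVneq x a; have [//|xb] := eqVneq x b; rewrite h.
Qed.

Lemma edge_at_neq0 m a b : edge_at m a b -> m != 0.
Proof.
move=> /edge_atP[_ _ h _]; have [x xS /andP[xa xb]] := third_vertex a b.
by apply: contraTneq (h x xS xa xb) => ->; rewrite !dot0l ltxx.
Qed.

(* Rotating the normal of an edge about the edge until it meets a further
   vertex produces a facet that contains the edge. *)
Lemma generic_edge d m a b : generic d -> a \in S -> b \in S ->
  edge_at m a b -> cross d (b - a) != 0.
Proof.
move=> gd aS bS em; have m0 := edge_at_neq0 em.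
have [ab mb h _] := edge_atP em; apply/eqP => hd.
have ba0 : b - a != 0 by rewrite subr_eq0 eq_sym.
pose q := cross (b - a) m; pose T := [seq x <- S | (x != a) && (x != b)].
have q0 : q != 0.
  apply/eqP => /(cross_eq0 ba0)[t et]; move/eqP: m0; apply; rewrite et.
  have : dot m (b - a) = 0 by rewrite dotBr mb subrr.
  rewrite et dotZl => /eqP; rewrite mulf_eq0 => /orP[/eqP->|].
    by rewrite scale0r.
  by rewrite gt_eqF// dot_gt0.
(* For [t = f x] the functional [q + t *: m] takes equal values at [x] and [a]; the largest such [t]
   makes [a] a maximiser on [S]. *)
pose f x := dot q (x - a) / (dot m a - dot m x).
have [v] : exists2 v, v \in T & forall y, y \in T -> f y <= f v.
  apply: seq_argmax; have [x xS xab] := third_vertex a b.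
  by apply/eqP => e; have : x \in T by [rewrite mem_filter xab]; rewrite e.
rewrite mem_filter => /andP[/andP[va vb] vS] hv.
pose w := q + f v *: m.
have wE x : dot w x - dot w a = dot q (x - a) - f v * (dot m a - dot m x).
  by rewrite /w !dotDl !dotZl dotBr; ring.
have qb : dot q (b - a) = 0 by rewrite dotC dot_crossl.
have wb : dot w b = dot w a.
  by apply/eqP; rewrite -subr_eq0 wE qb mb subrr mulr0 subrr.
have wd : dot w d = 0.
  have [t ->] : exists t, d = t *: (b - a).
    by apply: cross_eq0 => //; rewrite crossC hd oppr0.
  by rewrite dotZr dotBr wb subrr mulr0.
apply: (@generic_facet d w a b v) => //.
- apply/eqP => w0; have : dot w q = 0 by rewrite w0 dot0l.
  rewrite /w dotDl dotZl dot_crossr mulr0 addr0 => /dot_eq0 /eqP.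
  by rewrite (negPf q0).
- move=> x xS; have [->//|xa] := eqVneq x a.
  have [->|xb] := eqVneq x b; first by rewrite wb.
  rewrite -subr_le0 wE; have mx := h x xS xa xb.
  have := hv x; rewrite mem_filter xa xb xS => /(_ isT).
  by rewrite {1}/f ler_pdivrMr ?subr_gt0// subr_le0.
- apply/eqP; rewrite -subr_eq0 wE /f divfK ?subrr//.
  by rewrite gt_eqF// subr_gt0 h.
Qed.

Lemma sedge_neq d a b : sedge d a b -> a != b.
Proof. by case/andP. Qed.

Lemma sedge_gt0 d a b x : sedge d a b -> x \in S -> x != a -> x != b ->
  0 < dot d (cross (b - a) (x - a)).
Proof.
by move=> /andP[_ /allP h] xS /negPf xa /negPf xb; have := h x xS; rewrite xa xb.
Qed.

Lemma sedgeI d a b : a != b ->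
  (forall x, x \in S -> x != a -> x != b -> 0 < dot d (cross (b - a) (x - a))) ->
  sedge d a b.
Proof.
move=> ab h; rewrite /sedge ab; apply/allP => x xS.
by have [//|xa] := eqVneq x a; have [//|xb] := eqVneq x b; rewrite h.
Qed.

(** For two successors of [a], a triple product and its negative would both be positive. *)
Lemma sedge_inj d a b b' : b \in S -> b' \in S ->
  sedge d a b -> sedge d a b' -> b = b'.
Proof.
move=> bS bS' e e'; apply/eqP; apply/negP => /negP nb.
have ab := sedge_neq e; have ab' := sedge_neq e'.
have := sedge_gt0 e bS'; rewrite eq_sym ab' eq_sym nb => /(_ isT isT).
have := sedge_gt0 e' bS; rewrite eq_sym ab nb crossC dotNr => /(_ isT isT).
lra.
Qed.

(** The functional [- cross d (b - a)] is maximal at both [a] and [b]; subtracting a small multiple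
    of [proj d (b - a)] breaks the tie in favour of [a]. *)
Lemma sedge_silh d a b : d != 0 -> sedge d a b -> silh d a.
Proof.
move=> d0 e; have ab := sedge_neq e.
have [y yS /andP[ya yb]] := third_vertex a b.
have pba : proj d (b - a) != 0.
  apply/eqP => h; have := sedge_gt0 e yS ya yb.
  rewrite dot_cross; have := @proj_eq _ d (b - a) 0 d0.
  rewrite h subr0 => ->; first by rewrite dot0l ltxx.
  by rewrite /proj dot0l mul0r scale0r subr0.
have [t t0 ht] : exists2 t, 0 < t & forall x,
    x \in [seq x <- S | (x != a) && (x != b)] ->
    0 < dot d (cross (b - a) (x - a)) + t * dot (proj d (b - a)) (x - a).
  apply: near0_ex; apply: near0_all => x; rewrite mem_filter.
  by move=> /andP[/andP[xa xb] xS]; apply: near0_gt; exact: sedge_gt0.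
exists (- (cross d (b - a) + t *: proj d (b - a))); split.
  by rewrite dotNl dotDl dotZl dot_proj_self// dotC dot_crossl mulr0 addr0 oppr0.
move=> x xS xa; rewrite -subr_lt0 -dotBr dotNl oppr_lt0 dotDl dotZl -dot_cross.
have [->|xb] := eqVneq x b.
  rewrite cross_self dot0r add0r mulr_gt0//.
  have -> : dot (proj d (b - a)) (b - a) = dot (proj d (b - a)) (proj d (b - a)).
    by rewrite [RHS]dot_proj_perp// dot_proj_self.
  exact: dot_gt0.
by apply: ht; rewrite mem_filter xa xb.
Qed.

(* Among the vertices seen from [a], the next one on the silhouette is the one
   of maximal slope with respect to the frame [(w, cross d w)]. *)
Lemma silh_sedge d a : d != 0 -> generic d -> a \in S -> silh d a ->
  exists2 b, b \in S & sedge d a b.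
Proof.
move=> d0 gd aS [w [wd hw]].
pose q := cross d w; pose f x := dot q (x - a) / (dot w a - dot w x).
pose T := [seq x <- S | x != a].
have [b] : exists2 v, v \in T & forall y, y \in T -> f y <= f v.
  apply: seq_argmax; have [x xS /andP[xa _]] := third_vertex a a.
  by apply/eqP => e; have : x \in T by [rewrite mem_filter xa]; rewrite e.
rewrite mem_filter => /andP[ba bS] hb; exists b => //.
have wb := hw b bS ba.
have w0 : w != 0 by apply: contraTneq wb => ->; rewrite !dot0l ltxx.
have ww := dot_gt0 w0.
(* Divided by the two positive differences of [w], the right side is [f b - f x]: the sign of the
   triple product compares slopes. *)
have E x : dot w w * dot d (cross (b - a) (x - a)) =
    (dot w a - dot w x) * dot q (b - a) - (dot w a - dot w b) * dot q (x - a).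
  rewrite -dotZl (_ : dot w w *: d = cross w q).
    by rewrite dotBr; coords; ring.
  by rewrite cross_cross wd scale0r subr0.
have ge0 x : x \in S -> 0 <= dot d (cross (b - a) (x - a)).
  move=> xS; have [->|xa] := eqVneq x a; first by rewrite subrr cross0r dot0r.
  rewrite -(pmulr_rge0 _ ww) E; have wx := hw x xS xa.
  have := hb x; rewrite mem_filter xa xS => /(_ isT).
  by rewrite /f ler_pdivrMr ?subr_gt0// mulrAC ler_pdivlMr ?subr_gt0//; nra.
apply: sedgeI => [|x xS xa xb]; first by rewrite eq_sym.
rewrite lt_neqAle ge0// andbT; apply/eqP => h0.
have nE y : dot (- cross d (b - a)) y =
    dot (- cross d (b - a)) a - dot d (cross (b - a) (y - a)).
  by coords; ring.
(* A vanishing triple product would put [x] on a supporting plane through [a] and [b] that is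
   parallel to [d]. *)
apply: (@generic_facet d (- cross d (b - a)) a b x) => //.
- rewrite oppr_eq0; apply: contraTneq wb => /(cross_eq0 d0)[t et].
  rewrite -leNgt -subr_le0 -opprB -dotBr et dotZr wd mulr0 oppr0//.
- by rewrite dotNl dotC dot_crossl oppr0.
- by rewrite eq_sym.
- by move=> y yS; rewrite [X in X <= _]nE gerBl ge0.
- by rewrite nE cross_self dot0r subr0.
- by rewrite nE -h0 subr0.
Qed.

(** * Vertices of the projected polygon *)

Lemma proj_conv_cvx d : cvx (proj d @` P).
Proof.
move=> _ _ t [x Px <-] [y Py <-] t01.
by exists (t *: x + (1 - t) *: y); [exact: conv_cvx|rewrite projD !projZ].
Qed.

Lemma extreme_cvx (X : set vec) q : cvx X -> extreme X q ->
  cvx [set z | X z /\ z <> q].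
Proof.
move=> cX [Xq ext] x y t [Xx xq] [Xy yq] t01; split; first exact: cX.
move=> /esym e; have xy := ext x y t Xx Xy t01 e.
by apply: xq; rewrite e -xy -scalerDl addrC subrK scale1r.
Qed.

Lemma silh_inj d a b : a \in S -> b \in S -> silh d a ->
  proj d a = proj d b -> a = b.
Proof.
move=> aS bS [w [wd hw]] e; apply/eqP; apply/negP => /negP ab.
have := hw b bS; rewrite eq_sym ab => /(_ isT).
by rewrite -[dot w b](dot_proj_perp _ wd) -e dot_proj_perp// ltxx.
Qed.

Lemma silh_extreme d a : a \in S -> silh d a ->
  extreme (proj d @` P) (proj d a).
Proof.
move=> aS [w [wd hw]]; split; first by exists a => //; exact: conv_mem.
have K x : P x -> dot w x <= dot w a /\ (dot w x = dot w a -> x = a).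
  apply: (conv_face (@set1_cvx _ a)) => {}x xS.
  by have [->|xa] := eqVneq x a; [right|left; exact: hw].
move=> _ _ t [x Px <-] [y Py <-] t01 /(congr1 (dot w)).
rewrite [RHS]dotDr !dotZr !dot_proj_perp// => e.
have [hx ex] := K x Px; have [hy ey] := K y Py.
by have [/ex -> /ey ->] := convex_comb_max t01 hx hy e.
Qed.

(** An extreme point [q] is the image of a vertex [a] and lies outside the hull of the images
    different from [q]. A separating functional, projected along [d], exposes [a] unless a second
    vertex lies over [q]; the two would then span an edge parallel to [d], which [generic_edge]
    excludes. *)
Lemma extreme_silh d q : d != 0 -> generic d -> extreme (proj d @` P) q ->
  exists2 a, a \in S & silh d a /\ q = proj d a.
Proof.
move=> d0 gd ext; have cK := extreme_cvx (@proj_conv_cvx d) ext.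
have [[x0 Px0 ex0] _] := ext.
have [a aS ea] : exists2 a, a \in S & proj d a = q.
  apply/not_exists2P => h; suff : proj d x0 <> q by [].
  move: x0 Px0 {ex0}; suff : P `<=` [set x | P x /\ proj d x <> q].
    by move=> H x0 /H[].
  apply: conv_min => [x y t [Px hx] [Py hy] t01|v vS].
    split; first exact: conv_cvx.
    rewrite projD !projZ.
    have [||//] := cK (proj d x) (proj d y) t _ _ t01.
      by split=> //; exists x.
    by split=> //; exists y.
  by split; [exact: conv_mem|move=> e; have := h v; case].
have [|[w hw]] := separation [seq proj d x | x <- [seq x <- S | proj d x != q]] q.
  move=> c; have := conv_min cK _ c; case=> //.
  move=> _ /mapP[x + ->]; rewrite mem_filter => /andP[/eqP ne xS].
  by split=> //; exists x => //; exact: conv_mem.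
have hw' x : x \in S -> proj d x != q -> dot (proj d w) x < dot (proj d w) a.
  move=> xS xq; rewrite -!dot_proj ea; apply: hw.
  by apply: map_f; rewrite mem_filter xq.
have wd : dot (proj d w) d = 0 by exact: dot_proj_self.
have wq x : proj d x = q -> dot (proj d w) x = dot (proj d w) a.
  by move=> xq; rewrite -!dot_proj xq ea.
exists a => //; split=> //; exists (proj d w); split=> // x xS xa.
have [/eqP xq|] := boolP (proj d x == q); last exact: hw'.
exfalso; have cxa : cross d (x - a) = 0 by apply: proj_eq => //; rewrite xq.
(* Otherwise all vertices would project to [q], and [P] would lie on a line parallel to [d]. *)
have w0 : proj d w != 0.
  apply/eqP => w0; have [n n0 nd] := ex_perp d.
  have [y yS /eqP] := nS (dot n a) n0; apply.
  have : proj d y = q.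
    by apply/eqP; apply/negP => /negP /(hw' _ yS); rewrite w0 !dot0l ltxx.
  rewrite -ea => /(proj_eq d0) /(cross_eq0 d0) [t et].
  by apply/eqP; rewrite -subr_eq0 -dotBr et dotZr nd mulr0.
have em : edge_at (proj d w) a x.
  apply: edge_atI => [||y yS ya yx]; first by rewrite eq_sym.
    exact: wq.
  have [/eqP yq|] := boolP (proj d y == q); last exact: hw'.
  exfalso; apply: (@generic_facet d (proj d w) a x y) => //.
  - by rewrite eq_sym.
  - move=> z zS; have [/eqP zq|] := boolP (proj d z == q); first by rewrite wq.
    by move=> /(hw' _ zS)/ltW.
  - exact: wq.
  - exact: wq.
by have := generic_edge gd aS xS em; rewrite cxa eqxx.
Qed.

Definition pairs := [seq (a, b) | a <- S, b <- S].

Lemma pairs_uniq : uniq pairs.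
Proof. by apply: allpairs_uniq => // -[a b] [a' b'] _ _ []/= -> ->. Qed.

Lemma mem_pairs a b : ((a, b) \in pairs) = (a \in S) && (b \in S).
Proof.
apply/allpairsP/andP => [[[x y] /= [xS yS [-> ->]]]|[aS bS]]; first by [].
by exists (a, b).
Qed.

(** Sending a pair to the projection of its first entry is a bijection onto the vertices: [silh_inj]
    and [sedge_inj] give injectivity, [extreme_silh] and [silh_sedge] surjectivity. *)
Lemma card_extreme_proj d : d != 0 -> generic d ->
  card_eq (extreme (proj d @` P)) (count (fun z => sedge d z.1 z.2) pairs).
Proof.
move=> d0 gd; pose T := [seq z <- pairs | sedge d z.1 z.2].
have TP z : z \in T -> [/\ z.1 \in S, z.2 \in S & sedge d z.1 z.2].
  by case: z => a b; rewrite mem_filter mem_pairs => /and3P[].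
exists [seq proj d z.1 | z <- T]; split.
  rewrite map_inj_in_uniq ?filter_uniq ?pairs_uniq//.
  move=> [a b] [a' b'] /TP/=[aS bS e] /TP/=[aS' bS' e'] h.
  have aa := silh_inj aS aS' (sedge_silh d0 e) h; rewrite -aa in e' *.
  by rewrite (sedge_inj bS bS' e e').
split; first by rewrite size_map size_filter.
move=> x; split.
  by move=> /mapP[p /TP[pS qS e] ->]; apply: silh_extreme => //; exact: sedge_silh e.
move=> /(extreme_silh d0 gd)[a aS [sa ->]].
have [b bS e] := silh_sedge d0 gd aS sa.
by apply/mapP; exists (a, b) => //; rewrite mem_filter e mem_pairs aS.
Qed.

End Polytope.

(** * Counting in lists *)

Lemma count_split (T : Type) (p q : pred T) (s : seq T) :
  count p s = (count (fun z => p z && q z) s + count (fun z => p z && ~~ q z) s)%N.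
Proof.
by elim: s => //= z s ->; case: (p z); case: (q z); rewrite /= ?addnS.
Qed.

Lemma count_at_most_one (T : eqType) (p : pred T) (s : seq T) : uniq s ->
  (forall x y, x \in s -> y \in s -> p x -> p y -> x = y) -> count p s = has p s.
Proof.
elim: s => //= a s IH /andP[as' us] h; have [pa|pa] := boolP (p a).
  suff -> : count p s = 0%N by [].
  rewrite -(count_pred0 s); apply/eq_in_count => x xs; apply/negP => px; move: as'.
  by rewrite (h a x) ?xs ?mem_head// inE xs orbT.
by rewrite add0n IH// => x y xs ys; apply: h; rewrite inE ?xs ?ys orbT.
Qed.

(** * Normal cones of edges and the aggregated cone *)

Section EdgeCones.
Variable R : realType.
Notation vec := 'rV[R]_3.
Implicit Types (a b c d l m n p q u v w x y : vec) (s t : R).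

Variable S : seq vec.
Hypothesis uS : uniq S.
Hypothesis eS : all_exposed S.
Hypothesis nS : forall n t, n != 0 -> exists2 x, x \in S & dot n x != t.

Notation P := (conv S).

(** When [ab] is an edge this is its closed normal cone, with [edge_at] describing the relative
    interior. *)
Definition edge_cone a b w :=
  dot w b = dot w a /\ forall x, x \in S -> dot w x <= dot w a.

Definition par_edge u a b :=
  [/\ a \in S, b \in S, cross u (b - a) = 0 & exists m, edge_at S m a b].

Lemma face_edge_eq m a b w x : edge_at S m a b -> face S m x -> a \in S ->
  dot w b = dot w a -> dot w x = dot w a.
Proof.
move=> em fx aS wb; have [ab mb h hm] := edge_atP em.
have [Px mx] := (faceP aS hm x).1 fx.
have := conv_face (w := m) (t := dot m a) (@plane_cvx _ w (dot w a)) _ Px.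
case=> [y yS|_ ->//]; have [->|ya] := eqVneq y a; first by right.
by have [->|yb] := eqVneq y b; [right|left; exact: h].
Qed.

Lemma face_edge_line m a b x : edge_at S m a b -> face S m x -> a \in S ->
  cross (b - a) (x - a) = 0.
Proof.
move=> em fx aS; have [ab mb h hm] := edge_atP em.
have [Px mx] := (faceP aS hm x).1 fx.
have := conv_face (w := m) (t := dot m a) (@line_cvx _ a (b - a)) _ Px.
case=> [y yS|_ ->//]; have [->|ya] := eqVneq y a.
  by right; rewrite /= subrr cross0r.
by have [->|yb] := eqVneq y b; [right; rewrite /= cross_self|left; exact: h].
Qed.

Lemma face_vertex_eq c a x : a \in S ->
  (forall y, y \in S -> y != a -> dot c y < dot c a) -> face S c x -> x = a.
Proof.
move=> aS h fx.
have hm y : y \in S -> dot c y <= dot c a.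
  by move=> yS; have [->//|ya] := eqVneq y a; rewrite ltW ?h.
have [Px cx] := (faceP aS hm x).1 fx.
have := conv_face (w := c) (t := dot c a) (@set1_cvx _ a) _ Px.
by case=> [y yS|_ ->//]; have [->|ya] := eqVneq y a; [right|left; exact: h].
Qed.

Lemma ncone_edge m a b w : a \in S -> b \in S -> edge_at S m a b ->
  ncone P (face S m) w <-> edge_cone a b w.
Proof.
move=> aS bS em; have [ab mb h hm] := edge_atP em; have fP := faceP aS hm.
have fa : face S m a by apply/fP; split=> //; exact: conv_mem.
have fb : face S m b by apply/fP; split=> //; exact: conv_mem.
split=> [nw|[wb hw]].
  split; last by move=> x xS; apply: nw => //; exact: conv_mem.
  by apply/eqP; rewrite eq_le !nw//; exact: conv_mem.
move=> x y Px fy; rewrite (face_edge_eq em fy aS wb).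
exact: dot_conv_le Px.
Qed.

(** The three cases are a vertex, an edge, and a face of dimension at least 2. *)
Lemma face_cases c : exists2 a, a \in S &
  (forall x, x \in S -> dot c x <= dot c a) /\
  [\/ forall x, x \in S -> x != a -> dot c x < dot c a,
      exists2 b, b \in S & edge_at S c a b |
      exists b v, [/\ b \in S, v \in S, a != b, v != a & v != b] /\
                  (dot c b = dot c a /\ dot c v = dot c a)].
Proof.
have [a aS ha] := support nS c; exists a => //; split=> //.
have [h|/existsNP[b /not_implyP[bS /not_implyP[ba /negP]]]] :=
    pselect (forall x, x \in S -> x != a -> dot c x < dot c a).
  by constructor 1.
rewrite -leNgt => cb; have {}cb : dot c b = dot c a.
  by apply/eqP; rewrite eq_le ha.
have [h|] := pselect (forall x, x \in S -> x != a -> x != b -> dot c x < dot c a).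
  by constructor 2; exists b => //; apply: edge_atI => //; rewrite eq_sym.
move=> /existsNP[v /not_implyP[vS /not_implyP[va /not_implyP[vb /negP]]]].
rewrite -leNgt => cv; have {}cv : dot c v = dot c a.
  by apply/eqP; rewrite eq_le ha.
by constructor 3; exists b, v; rewrite eq_sym.
Qed.

Lemma edge_cone_perturb m a b z : edge_at S m a b -> dot z b = dot z a ->
  near0 (fun e => edge_cone a b (m + e *: z)).
Proof.
move=> em zb; have [ab mb h hm] := edge_atP em.
have N : near0 (fun e => forall x, x \in [seq x <- S | (x != a) && (x != b)] ->
    0 < (dot m a - dot m x) + e * (dot z a - dot z x)).
  apply: near0_all => x; rewrite mem_filter => /andP[/andP[xa xb] xS].
  by apply: near0_gt; rewrite subr_gt0 h.
apply: near0_imp N => e e0 he; split; first by rewrite !dotDl !dotZl mb zb.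
move=> x xS; rewrite !dotDl !dotZl; have [->//|xa] := eqVneq x a.
have [->|xb] := eqVneq x b; first by rewrite mb zb.
by have := he x; rewrite mem_filter xa xb xS => /(_ isT); lra.
Qed.

(** The two-dimensional normal cones inside the plane orthogonal to [u] are those of the edges
    parallel to [u]: the cone of a vertex leaves the plane by a small step along [u], and the cone
    of a face with three vertices lies in a line. *)
Lemma agg_coneP u w : u != 0 ->
  agg_cone P u w <-> exists a b, par_edge u a b /\ edge_cone a b w.
Proof.
move=> u0; split=> [[_ [[c ->] [dimN [sub nw]]]]|]; last first.
  move=> [a [b [[aS bS uab [m em]] ew]]].
  have nE := ncone_edge _ aS bS em.
  have [ab mb h hm] := edge_atP em; have m0 := edge_at_neq0 nS em.
  have ba0 : b - a != 0 by rewrite subr_eq0 eq_sym.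
  have Nperp x : ncone P (face S m) x -> dot (b - a) x = 0.
    by move=> /nE[xb _]; rewrite dotC dotBr xb subrr.
  exists (face S m); split; first by exists m.
  split; last first.
    split; last exact/nE.
    move=> x /Nperp; have [t et] := cross_eq0 u0 uab.
    have t0 : t != 0 by apply: contra_neq ba0 => t0; rewrite et t0 scale0r.
    rewrite et dotZl => /eqP; rewrite mulf_eq0 (negPf t0) => /eqP.
    by rewrite /perp/= dotC.
  split; last first.
    by move=> h3; apply: (dim_ge3_nonplanar (t := 0) h3 ba0).
  have qb : dot (cross (b - a) m) b = dot (cross (b - a) m) a.
    by apply/eqP; rewrite -subr_eq0 -dotBr dotC dot_crossl.
  have [e e0 he] := near0_ex (edge_cone_perturb em qb).
  apply: (@dim_ge2I _ _ 0 m (m + e *: cross (b - a) m)).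
  - by apply/nE; split=> [|x _]; rewrite !dot0l.
  - exact/nE.
  - exact/nE.
  - have ml : dot m (b - a) = 0 by rewrite dotBr mb subrr.
    rewrite !subr0 crossDr cross_self add0r crossZr cross_cross ml scale0r subr0.
    by rewrite !scaler_eq0 !gt_eqF//= dot_gt0.
have [a aS [ha]] := face_cases c; have fP := faceP aS ha.
have fa : face S c a by apply/fP; split=> //; exact: conv_mem.
case=> [h|[b bS em]|[b [v [[bS vS ab va vb] [cb cv]]]]].
- exfalso.
  have [e e0 he] : exists2 e, 0 < e & forall x, x \in [seq x <- S | x != a] ->
      0 < (dot c a - dot c x) + e * (dot u a - dot u x).
    apply/near0_ex/near0_all => x; rewrite mem_filter => /andP[xa xS].
    by apply: near0_gt; rewrite subr_gt0 h.
  have : ncone P (face S c) (c + e *: u).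
    move=> x y Px /(face_vertex_eq aS h) ->; apply: dot_conv_le Px.
    move=> z zS; have [->//|za] := eqVneq z a.
    have := he z; rewrite mem_filter za zS => /(_ isT).
    by rewrite !dotDl !dotZl; lra.
  move=> /sub; rewrite /perp/= dotDl dotZl.
  have : ncone P (face S c) c.
    by move=> x y Px /fP[_ ->]; apply: dot_conv_le Px.
  move=> /sub; rewrite /perp/= => ->; rewrite add0r => /eqP.
  by rewrite mulf_eq0 !gt_eqF// dot_gt0.
- have nE := ncone_edge _ aS bS em.
  exists a, b; split; last exact/nE.
  split=> //; last by exists c.
  (* A positive multiple of the component of [u] orthogonal to the edge; its product with [u] is the
     squared length of [cross u (b - a)]. *)
  pose z := cross (b - a) (cross u (b - a)).
  have zb : dot z b = dot z a.
    by apply/eqP; rewrite -subr_eq0 -dotBr dotC dot_crossl.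
  have [ab cb _ hc] := edge_atP em.
  have [e e0 he] := near0_ex (edge_cone_perturb em zb).
  have : perp u (c + e *: z) by apply/sub/nE.
  have cu : perp u c by apply/sub/nE.
  rewrite /perp/= dotDl dotZl cu add0r => /eqP.
  rewrite mulf_eq0 gt_eqF//= => /eqP zu; apply: dot_eq0; rewrite -zu /z.
  by rewrite [RHS]dotC [RHS]dot_cross.
- exfalso; have [p [q [r [Np Nq Nr /negP]]]] := dim_ge2E dimN.1; apply.
  have fb : face S c b by apply/fP; split=> //; exact: conv_mem.
  have fv : face S c v by apply/fP; split=> //; exact: conv_mem.
  have E n : ncone P (face S c) n -> dot n b = dot n a /\ dot n v = dot n a.
    by move=> Nn; split; apply/eqP; rewrite eq_le !Nn//; exact: conv_mem.
  have y0 := noncollinear eS aS bS vS ab va vb.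
  have O n n' : ncone P (face S c) n -> ncone P (face S c) n' ->
      exists t, n - n' = t *: cross (b - a) (v - a).
    move=> /E[nb nv] /E[nb' nv']; apply: orth_both y0.
      by rewrite dotBl !dotBr nb nb' !subrr.
    by rewrite dotBl !dotBr nv nv' !subrr.
  have [t ->] := O _ _ Nq Np; have [t' ->] := O _ _ Nr Np.
  by rewrite crossZl crossZr cross_self !scaler0 eqxx.
Qed.

Lemma edge_direction_par u : edge_direction P u -> exists a b, par_edge u a b.
Proof.
move=> [uu [_ [E [x [y [t [[[c ->] [dim1 dim2]] [[fx _] [[fy _] [xy e]]]]]]]]]].
have t0 : t != 0.
  apply: contra_neq xy => t0; apply/esym/eqP.
  by rewrite -subr_eq0 e t0 scale0r.
have [a aS [ha]] := face_cases c; have fP := faceP aS ha.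
case=> [h|[b bS em]|[b [v [[bS vS ab va vb] [cb cv]]]]].
- by move: xy; rewrite (face_vertex_eq aS h fx) (face_vertex_eq aS h fy) eqxx.
- exists a, b; split=> //; last by exists c.
  have lx := face_edge_line em fx aS; have ly := face_edge_line em fy aS.
  have : cross (b - a) (y - x) = 0.
    have -> : y - x = (y - a) - (x - a) by vring.
    by rewrite crossDr crossNr lx ly subrr.
  rewrite e crossZr => /eqP; rewrite scaler_eq0 (negPf t0)/= => /eqP h.
  by rewrite crossC h oppr0.
- exfalso; apply: dim2; apply: (@dim_ge2I _ _ a b v); last exact: (noncollinear eS).
  + by apply/fP; split=> //; exact: conv_mem.
  + by apply/fP; split=> //; exact: conv_mem.
  + by apply/fP; split=> //; exact: conv_mem.
Qed.

Lemma first_neq0 l : l != 0 ->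
  exists i : 'I_3, (forall j : 'I_3, (j < i)%N -> l 0 j = 0) /\ l 0 i != 0.
Proof.
move=> l0; have [e0|] := eqVneq (l 0 i0) 0; last by exists i0.
have [e1|h] := eqVneq (l 0 i1) 0; last first.
  exists i1; split=> // -[[|j] hj]//= _.
  by rewrite -[RHS]e0; congr (l 0 _); apply: val_inj.
exists i2; split=> [[[|[|j]] hj]//= _|].
- by rewrite -[RHS]e0; congr (l 0 _); apply: val_inj.
- by rewrite -[RHS]e1; congr (l 0 _); apply: val_inj.
- by apply: contra_neq l0 => e2; apply: vecP; rewrite !mxE.
Qed.

Lemma face_extreme m a : face S m a -> a \in S -> extreme (face S m) a.
Proof.
move=> fa aS; split=> // x y t [Px _] [Py _] t01 e.
have [w hw] := eS aS.
have K z : P z -> dot w z <= dot w a /\ (dot w z = dot w a -> z = a).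
  apply: (conv_face (@set1_cvx _ a)) => {}z zS.
  by have [->|za] := eqVneq z a; [right|left; exact: hw].
have {e} := congr1 (dot w) e; rewrite dotDr !dotZr => e.
have [hx ex] := K x Px; have [hy ey] := K y Py.
by have [/ex -> /ey ->] := convex_comb_max t01 hx hy e.
Qed.

Lemma edge_has_direction m a b : a \in S -> b \in S -> edge_at S m a b ->
  exists2 u, edge_direction P u & cross u (b - a) = 0.
Proof.
move=> aS bS em; have [ab mb h hm] := edge_atP em; have fP := faceP aS hm.
have fa : face S m a by apply/fP; split=> //; exact: conv_mem.
have fb : face S m b by apply/fP; split=> //; exact: conv_mem.
have ba0 : b - a != 0 by rewrite subr_eq0 eq_sym.
have ll := dot_gt0 ba0; have [i [hi li]] := first_neq0 ba0.
(* The sign makes the first non-zero coordinate positive, the square root makes the length 1. *)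
pose s := Num.sg ((b - a) 0 i) / Num.sqrt (dot (b - a) (b - a)).
have sq : Num.sqrt (dot (b - a) (b - a)) != 0 by rewrite gt_eqF// sqrtr_gt0.
have s0 : s != 0 by rewrite mulf_neq0 ?invr_eq0 ?sgr_eq0.
exists (s *: (b - a)); last by rewrite crossZl cross_self scaler0.
split.
  rewrite dotZl dotZr mulrA -expr2 /s exprMn exprVn sqr_sqrtr ?ltW//.
  by rewrite sqr_sg li mul1r mulVf ?gt_eqF.
split.
  exists i; split=> [j /hi hj|]; first by rewrite mxE hj mulr0.
  rewrite mxE /s mulrAC -normrEsg divr_gt0 ?normr_gt0 ?sqrtr_gt0//.
exists (face S m), a, b, s^-1; split; last first.
  split; first exact: face_extreme.
  split; first exact: face_extreme.
  by rewrite scalerA mulVf// scale1r.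
split; first by exists m.
split; first exact: dim_ge1I fa fb ab.
move=> /dim_ge2E[x [y [z [fx fy fz /negP]]]]; apply; apply/eqP.
apply: (cross_trans ba0).
  have -> : y - x = (y - a) - (x - a) by vring.
  by rewrite crossDr crossNr !(face_edge_line em)// subrr.
have -> : z - x = (z - a) - (x - a) by vring.
by rewrite crossDr crossNr !(face_edge_line em)// subrr.
Qed.

(** A finite criterion: a facet has three vertices [a], [b], [v], and all its normals are multiples
    of [cross (b - a) (v - a)]. *)
Lemma generic_triples d :
  (forall a b v, a \in S -> b \in S -> v \in S -> a != b -> v != a -> v != b ->
     dot d (cross (b - a) (v - a)) != 0) -> generic S d.
Proof.
move=> gd F [[c ->] [dim2 _]] [n [n0 [nd hn]]].
have [x [y [z [fx fy fz /negP]]]] := dim_ge2E dim2; apply; apply/eqP.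
have [a aS [ha]] := face_cases c; have fP := faceP aS ha.
case=> [h|[b bS em]|[b [v [[bS vS ab va vb] [cb cv]]]]].
- by rewrite (face_vertex_eq aS h fx) (face_vertex_eq aS h fy) subrr cross0l.
- have [ab _ _ _] := edge_atP em.
  have ba0 : b - a != 0 by rewrite subr_eq0 eq_sym.
  apply: (cross_trans ba0).
    have -> : y - x = (y - a) - (x - a) by vring.
    by rewrite crossDr crossNr !(face_edge_line em)// subrr.
  have -> : z - x = (z - a) - (x - a) by vring.
  by rewrite crossDr crossNr !(face_edge_line em)// subrr.
- exfalso.
  have fa : face S c a by apply/fP; split=> //; exact: conv_mem.
  have fb : face S c b by apply/fP; split=> //; exact: conv_mem.
  have fv : face S c v by apply/fP; split=> //; exact: conv_mem.
  have y0 := noncollinear eS aS bS vS ab va vb.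
  have [t et] := orth_both (hn b a fb fa) (hn v a fv fa) y0.
  move/eqP: nd; rewrite et dotZl mulf_eq0 dotC (negPf (gd _ _ _ _ _ _ _ _ _))// orbF.
  by move=> /eqP t0; move: n0; rewrite et t0 scale0r eqxx.
Qed.

(** * Counting the silhouette edges parallel to [u] *)

Definition par_count u d :=
  count (fun z => (cross u (z.2 - z.1) == 0) && sedge S d z.1 z.2) (pairs S).

(** A boolean version of membership of [m] in the aggregated cone; the two can differ only when [m]
    is maximal at a third vertex. *)
Definition strict_edge u m :=
  has (fun z => (cross u (z.2 - z.1) == 0) && edge_at S m z.1 z.2) (pairs S).

Lemma edge_at_sym m a b : edge_at S m a b -> edge_at S m b a.
Proof.
move=> /edge_atP[ab mb h _]; apply: edge_atI; rewrite 1?eq_sym//.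
by move=> x xS xb xa; rewrite mb h.
Qed.

Lemma edge_at_inj m a b a' b' : a' \in S -> b' \in S -> a \in S -> b \in S ->
  edge_at S m a b -> edge_at S m a' b' -> (a', b') = (a, b) \/ (a', b') = (b, a).
Proof.
move=> aS' bS' aS bS /edge_atP[ab mb h hm] /edge_atP[ab' mb' _ hm'].
have H x : x \in S -> dot m x = dot m a' -> (x == a) || (x == b).
  move=> xS e; apply/negP => /negP; rewrite negb_or => /andP[xa xb].
  by have := h x xS xa xb; rewrite e ltNge hm'.
have /predU1P[ea|/eqP ea] := H a' aS' erefl;
  have /predU1P[eb|/eqP eb] := H b' bS' mb'; rewrite ea eb; [| by left | by right |].
  by move: ab'; rewrite ea eb eqxx.
by move: ab'; rewrite ea eb eqxx.
Qed.

Lemma sedge_edge_at d u a b t : b - a = t *: u -> 0 < t ->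
  sedge S d a b = edge_at S (- cross d u) a b.
Proof.
move=> e t0; rewrite /sedge /edge_at; congr (_ && _).
have -> : dot (- cross d u) b == dot (- cross d u) a.
  rewrite -subr_eq0 -dotBr e dotZr mulf_eq0; apply/orP; right.
  by rewrite dotNl dotC dot_crossr oppr0.
apply: eq_all => x; congr [|| _, _ | _].
rewrite e crossZl dotZr pmulr_rgt0// dot_cross dotBr !dotNl.
by rewrite ltrN2 subr_gt0.
Qed.

(** A parallel pair pointing along [u] is a silhouette edge when [- cross d u] is a strict normal of
    it, and one pointing against [u] when [cross d u] is. A functional is strict for at most one
    edge, and exactly one order of its endpoints points along [u]. *)
Lemma par_countE u d : dot u u = 1 ->
  par_count u d = (strict_edge u (- cross d u) + strict_edge u (cross d u))%N.
Proof.
move=> uu; have u0 : u != 0.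
  by apply: contra_eq_neq uu => ->; rewrite dot0l eq_sym oner_neq0.
pose up z : bool := 0 < dot u (z.2 - z.1 : vec).
have parE a b : cross u (b - a) == 0 -> b - a = dot u (b - a) *: u.
  by move=> /eqP /(cross_eq0 u0) [t ->]; rewrite dotZr uu mulr1.
(* Fixing [sg] selects one of the two orders of the endpoints, so that each edge is counted once. *)
have key m (sg : bool) : (count (fun z => (cross u (z.2 - z.1) == 0) &&
    edge_at S m z.1 z.2 && (up z == sg)) (pairs S) = strict_edge u m :> nat).
  rewrite count_at_most_one ?pairs_uniq//.
    congr nat_of_bool; apply/hasP/hasP => [[z zS /andP[h _]]|[[a b]]].
      by exists z.
    rewrite mem_pairs => /andP[aS bS] /= /andP[p em].
    have [e|ne] := eqVneq (up (a, b)) sg.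
      by exists (a, b); rewrite ?mem_pairs ?aS//= p em e eqxx.
    exists (b, a); first by rewrite mem_pairs aS bS.
    rewrite /= edge_at_sym// andbT -opprB crossNr oppr_eq0 p /=.
    have l0 : dot u (b - a) != 0.
      have [ab _ _ _] := edge_atP em; apply/eqP => l0.
      have := parE a b p; rewrite l0 scale0r => /eqP; rewrite subr_eq0 eq_sym.
      by rewrite (negPf ab).
    move: ne; rewrite /up /= -[a - b]opprB dotNr oppr_gt0.
    by case: (ltgtP (dot u (b - a)) 0) l0 => //; case: sg.
  move=> [a b] [a' b']; rewrite !mem_pairs => /andP[aS bS] /andP[aS' bS'] /=.
  move=> /andP[/andP[p em] /eqP s1] /andP[/andP[p' em'] /eqP s2].
  have [//|[ea eb]] := edge_at_inj aS bS aS' bS' em' em.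
  move: s1 s2; rewrite ea eb /up /= -[a' - b']opprB dotNr oppr_gt0.
  have l0 : dot u (b' - a') != 0.
    have [ab _ _ _] := edge_atP em'; apply/eqP => l0.
    have := parE a' b' p'; rewrite l0 scale0r => /eqP; rewrite subr_eq0 eq_sym.
    by rewrite (negPf ab).
  by case: (ltgtP (dot u (b' - a')) 0) l0 => // _ _ <-.
rewrite /par_count (count_split _ up) -(key (- cross d u) true).
rewrite -(key (cross d u) false); congr (_ + _)%N; apply: eq_count => -[a b] /=.
  rewrite eqb_id; have [p|//] := boolP (_ == 0).
  have [h|h] := boolP (up _); rewrite ?andbF//= !andbT.
  exact: sedge_edge_at (parE a b p) h.
rewrite eqbF_neg; have [p|//] := boolP (_ == 0).
have [h|h] := boolP (up (a, b)); rewrite ?andbF//= !andbT.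
have [->|ab] := eqVneq a b; first by rewrite /sedge /edge_at eqxx.
rewrite -[cross d u]opprK -crossNr.
apply: (@sedge_edge_at _ _ _ _ (- dot u (b - a))).
  by rewrite scalerN scaleNr opprK; exact: parE.
rewrite oppr_gt0 lt_neqAle; move: h; rewrite /up/= -leNgt => ->; rewrite andbT.
apply/eqP => l0; have := parE a b p; rewrite l0 scale0r => /eqP.
by rewrite subr_eq0 eq_sym (negPf ab).
Qed.

Lemma strict_edgeP u m : reflect
  (exists a b, [/\ a \in S, b \in S, cross u (b - a) = 0 & edge_at S m a b])
  (strict_edge u m).
Proof.
apply: (iffP hasP) => [[[a b]]|[a [b [aS bS p em]]]].
  by rewrite mem_pairs => /andP[aS bS] /andP[/eqP p em]; exists a, b.
by exists (a, b); rewrite ?mem_pairs ?aS//= p eqxx.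
Qed.

Lemma strict_edge_agg u m : u != 0 -> strict_edge u m -> agg_cone P u m.
Proof.
move=> u0 /strict_edgeP[a [b [aS bS p em]]]; apply/agg_coneP => //.
have [_ mb _ hm] := edge_atP em.
by exists a, b; split; [split=> //; exists m|].
Qed.

(** A point of the closed cone of an edge that misses the relative interior is maximal at a third
    vertex; the second hypothesis rules this out. *)
Lemma agg_strict_edge u m : u != 0 ->
  (forall a b v, a \in S -> b \in S -> v \in S -> a != b -> v != a -> v != b ->
     cross u (b - a) = 0 -> (forall x, x \in S -> dot m x <= dot m a) ->
     dot m b = dot m a -> dot m v = dot m a -> False) ->
  agg_cone P u m -> strict_edge u m.
Proof.
move=> u0 H /(agg_coneP _ u0)[a [b [[aS bS p [c em]] [mb hm]]]].
have [ab _ _ _] := edge_atP em.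
apply/strict_edgeP; exists a, b; split=> //; apply: edge_atI => // x xS xa xb.
by rewrite lt_neqAle hm// andbT; apply/eqP; exact: (H a b x).
Qed.

End EdgeCones.

(** The list is exhausted one class of [r] at a time, and the two counts agree on each class. *)
Lemma count_classes (T : eqType) (r : rel T) (f g : pred T) (s : seq T) :
  (forall x, x \in s -> r x x) ->
  (forall x y z, x \in s -> y \in s -> z \in s -> r x y -> r x z -> r y z) ->
  (forall x, x \in s -> count (fun z => r x z && f z) s =
                        count (fun z => r x z && g z) s) ->
  count f s = count g s.
Proof.
move: {2}(size s) (leqnn (size s)) => n; elim: n s => [|n IH] s sn rr rt h.
  by case: s sn {rr rt h}.
case: s sn rr rt h => // x s sn rr rt h; move: (x :: s) (mem_head x s) sn rr rt h.
move=> {}s xs sn rr rt h.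
have rs y z : y \in s -> z \in s -> r y z -> r z y.
  by move=> ys zs yz; apply: (rt y z y) => //; exact: rr.
rewrite (count_split f (r x)) (count_split g (r x)).
have E p : count (fun z => p z && r x z) s = count (fun z => r x z && p z) s.
  by apply: eq_count => z; rewrite andbC.
rewrite !E h//; congr (_ + _)%N; pose s' := [seq z <- s | ~~ r x z].
have sub z : z \in s' -> z \in s by rewrite mem_filter => /andP[].
have F p : count (fun z => p z && ~~ r x z) s = count p s'.
  by rewrite count_filter; apply: eq_count => z.
rewrite !F; apply: IH.
- rewrite -ltnS (leq_trans _ sn)// size_filter -[ltnRHS](count_predC (r x)).
  rewrite -[X in (X < _)%N]add0n ltn_add2r -has_count.
  by apply/hasP; exists x => //; exact: rr.
- by move=> y /sub; exact: rr.
- by move=> y z t /sub ys /sub zs /sub ts; exact: rt.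
move=> y; rewrite mem_filter => /andP[xy ys].
have G p : count (fun z => r y z && p z) s' = count (fun z => r y z && p z) s.
  rewrite count_filter; apply: eq_in_count => z zs /=.
  have [yz|//] := boolP (r y z); case: (p z) => //=.
  apply: contra xy => xz; apply: (rt z x y) => //; exact: rs.
by rewrite !G h.
Qed.

Lemma count_sum_eq (T : eqType) (f g f' g' : pred T) (s : seq T) :
  (forall z, z \in s -> f z + g z = f' z + g' z)%N ->
  (count f s + count g s = count f' s + count g' s)%N.
Proof.
elim: s => //= z s IH h.
rewrite addnACA (h z (mem_head z s)) IH 1?addnACA// => y ys.
by apply: h; rewrite inE ys orbT.
Qed.

(** * Perturbed directions, generic normals and the two implications *)

Section Equiprojective.
Variable R : realType.
Notation vec := 'rV[R]_3.
Implicit Types (a b c d l m n p q u v w x y : vec) (s t : R).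

(** By Cauchy-Schwarz. As in [relint], [e] bounds a squared length, hence the square of [s] in the
    bound. *)
Lemma near0_ball s p : 0 < s ->
  near0 (fun e : R => forall z : vec, dot z z < e -> 0 < s + dot z p).
Proof.
move=> s0; have D : 0 < dot p p + 1 by rewrite ltr_wpDl ?dot_ge0.
exists (s ^+ 2 / (dot p p + 1)); first by rewrite divr_gt0// exprn_gt0.
move=> e /andP[e0]; rewrite ltr_pdivlMr// => es z ze.
rewrite ltNge; apply/negP => h.
have sp : s <= - dot z p by lra.
have : s ^+ 2 <= dot z p ^+ 2 by rewrite -(sqrrN (dot z p)) lerXn2r ?nnegrE; lra.
have := cauchy_schwarz z p; have := dot_ge0 p; have := dot_ge0 z; nra.
Qed.

Lemma near0_line (Q : vec -> Prop) p :
  near0 (fun e => forall z, dot z z < e -> Q z) -> near0 (fun t => Q (t *: p)).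
Proof.
move=> /near0_ex[e e0 h].
have N1 : near0 (fun t : R => t < 1) by exists 1 => // t /andP[].
apply: near0_imp (near0_and N1 (near0_gt (- dot p p) e0)) => t t0 [t1 te].
by apply: h; rewrite dotZl dotZr; have := dot_ge0 p; nra.
Qed.

(** A vector that avoids all planes but one is moved slightly along the normal of the last. *)
Lemma ex_nonorthogonal (Y : seq vec) : (forall y, y \in Y -> y != 0) ->
  exists g, forall y, y \in Y -> dot g y != 0.
Proof.
elim: Y => [|y Y IH] h; first by exists 0.
have [g hg] : exists g, forall z, z \in Y -> dot g z != 0.
  by apply: IH => z zY; apply: h; rewrite inE zY orbT.
have [e e0 he] : exists2 e, 0 < e & forall z, z \in y :: Y ->
    dot g z + e * dot y z != 0.
  apply/near0_ex/near0_all => z; rewrite inE => /predU1P[->|zY]; apply: near0_neq.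
    by apply/orP; right; rewrite gt_eqF// dot_gt0// h ?mem_head.
  by rewrite hg.
by exists (g + e *: y) => z zY; rewrite dotDl dotZl he.
Qed.

Variable S : seq vec.
Hypothesis uS : uniq S.
Hypothesis eS : all_exposed S.
Hypothesis nS : forall n t, n != 0 -> exists2 x, x \in S & dot n x != t.

Notation P := (conv S).

(** Normals of the planes through three vertices; the zero vectors produced by repeated entries are
    filtered out. *)
Definition triples : seq vec :=
  [seq y <- [seq cross (z.2 - z.1) (v - z.1) | z <- pairs S, v <- S] | y != 0].

Lemma triples_neq0 y : y \in triples -> y != 0.
Proof. by rewrite mem_filter => /andP[]. Qed.

Lemma mem_triples a b v : a \in S -> b \in S -> v \in S ->
  a != b -> v != a -> v != b -> cross (b - a) (v - a) \in triples.
Proof.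
move=> aS bS vS ab va vb; rewrite mem_filter (noncollinear eS)//=.
apply/allpairsP; exists ((a, b), v); split=> //=; by rewrite mem_pairs aS.
Qed.

Section Direction.
Variable u : vec.
Hypothesis uu : dot u u = 1.

Let u0 : u != 0.
Proof. by apply: contra_eq_neq uu => ->; rewrite dot0l eq_sym oner_neq0. Qed.

Notation C := (agg_cone P u).

Lemma agg_perp w : C w -> dot w u = 0.
Proof. by move=> [F [_ [_ [sub Fw]]]]; have := sub _ Fw. Qed.

Lemma aff_agg_perp w : aff (negset C) w -> dot w u = 0.
Proof.
move=> [n [p [t [Cp [_ ->]]]]].
rewrite (big_morph (fun z => dot z u) (fun x y => dotDl x y u) (dot0l u)).
rewrite big1// => i _; have /agg_perp := Cp i.
by rewrite dotZl dotNl => /eqP; rewrite oppr_eq0 => /eqP ->; rewrite mulr0.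
Qed.

Lemma par_dot a b w : cross u (b - a) = 0 -> dot w u = 0 -> dot w b = dot w a.
Proof.
move=> /(cross_eq0 u0)[t e] wu; apply/eqP.
by rewrite -subr_eq0 -dotBr e dotZr wu mulr0.
Qed.

(** The affine hull of [- C] lies in the plane orthogonal to [u], where equality at [a] and [b] is
    automatic; the strict inequalities at the other vertices persist in a ball. *)
Lemma strict_edge_relint w : strict_edge S u (- w) -> relint (negset C) w.
Proof.
move=> se; split; first exact: strict_edge_agg nS _ _ u0 se.
have /strict_edgeP[a [b [aS bS p em]]] := se.
have [ab _ h _] := edge_atP em.
have [e e0 he] : exists2 e, 0 < e & forall x,
    x \in [seq x <- S | (x != a) && (x != b)] -> forall z, dot z z < e ->
    0 < (dot (- w) a - dot (- w) x) + dot z (x - a).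
  apply/near0_ex/near0_all => x; rewrite mem_filter => /andP[/andP[xa xb] xS].
  by apply: near0_ball; rewrite subr_gt0 h.
exists e; split=> // y /aff_agg_perp yu yw; apply/agg_coneP => //.
exists a, b; split; first by split=> //; exists (- w).
split; first by apply: par_dot => //; rewrite dotNl yu oppr0.
move=> x xS; have [->//|xa] := eqVneq x a.
have [->|xb] := eqVneq x b.
  by rewrite (@par_dot a b)// dotNl yu oppr0.
have := he x; rewrite mem_filter xa xb xS => /(_ isT _ yw).
by rewrite !dotNl dotBl !dotBr; lra.
Qed.

Lemma par_count_generic d : edge_direction P u -> generic S d ->
  (C = perp u -> par_count S u d = 2%N) /\
  (C `&` relint (negset C) = set0 /\ C `|` relint (negset C) = perp u ->
   par_count S u d = 1%N).
Proof.
move=> /(edge_direction_par eS nS)[a0 [b0 [aS0 bS0 p0 [m0 em0]]]] gd.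
set r := cross d u.
have r0 : r != 0.
  apply: contra_neq (generic_edge eS nS gd aS0 bS0 em0) => r0.
  by have [t ->] := cross_eq0 u0 p0; rewrite crossZr -/r r0 scaler0.
have rd : dot r d = 0 by rewrite dotC dot_crossl.
have ru : dot r u = 0 by rewrite dotC dot_crossr.
(* A non-zero normal orthogonal to a generic [d] is maximal at no three vertices, so it avoids the
   boundaries of the edge cones. *)
have A n : n != 0 -> dot n d = 0 -> (C n <-> strict_edge S u n).
  move=> n0 nd; split; last exact: strict_edge_agg.
  apply: agg_strict_edge => // a b v aS bS vS ab va vb _ hm nb nv.
  exact: (generic_facet eS gd n0 nd aS bS vS ab va vb).
have Ar : C r <-> strict_edge S u r by apply: A.
have AN : C (- r) <-> strict_edge S u (- r).
  by apply: A; rewrite ?oppr_eq0// dotNl rd oppr0.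
rewrite (par_countE uS)// -/r; split=> [Cp|[disj cov]].
  have := Ar.1; have := AN.1; rewrite Cp /perp/= dotNl ru oppr0.
  by move=> /(_ erefl) -> /(_ erefl) ->.
(* Exactly one of [r] and [- r] is strict: if both were, [r] would lie in [C] and in the relative
   interior of [- C]. *)
have : (C `|` relint (negset C)) r by rewrite cov.
have nrel : C r -> ~ relint (negset C) r.
  by move=> Cr rr; have : set0 r by [rewrite -disj; split].
case=> [Cr|rr].
  rewrite (Ar.1 Cr); have [/strict_edge_relint|//] := boolP (strict_edge S u (- r)).
  by move=> /(nrel Cr).
have [CNr _] := rr; rewrite (AN.1 CNr).
by have [/Ar Cr|//] := boolP (strict_edge S u r); have := nrel Cr.
Qed.

(** When the normal of a vertex triple is orthogonal to [u], its sign at [u + e *: x] is decided by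
    [x], which therefore must not be orthogonal to it. *)
Definition gen x := forall y, y \in triples -> dot u y = 0 -> dot x y != 0.

Lemma genN x : gen x -> gen (- x).
Proof. by move=> gx y yY uy; rewrite dotNl oppr_eq0 gx. Qed.

(* The value of [sedge] at [u + e x] for all small [e > 0]. *)
Definition lsedge x a b := (a != b) && all (fun v => [|| v == a, v == b |
  (0 < dot u (cross (b - a) (v - a))) ||
  ((dot u (cross (b - a) (v - a)) == 0) && (0 < dot x (cross (b - a) (v - a))))]) S.

Lemma near0_sgn s t : near0 (fun e : R =>
  (0 < s + e * t) = ((0 < s) || ((s == 0) && (0 < t)))).
Proof.
have [s0|s0|->] := ltgtP s 0.
- have := near0_gt (- t) (_ : 0 < - s); rewrite oppr_gt0 => /(_ s0).
  by apply: near0_imp => e _ h; apply/negP => h'; lra.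
- by apply: near0_imp (near0_gt t s0) => e _ ->.
- by exists 1 => // e /andP[e0 _]; rewrite add0r pmulr_rgt0.
Qed.

Lemma near0_lsedge x : gen x -> near0 (fun e =>
  generic S (u + e *: x) /\
  forall z, z \in pairs S -> sedge S (u + e *: x) z.1 z.2 = lsedge x z.1 z.2).
Proof.
move=> gx.
have N1 : near0 (fun e => forall y, y \in triples -> dot u y + e * dot x y != 0).
  apply: near0_all => y yY; apply: near0_neq.
  by have [uy|//] := eqVneq (dot u y) 0; rewrite gx.
have N2 : near0 (fun e => forall z, z \in pairs S -> forall v, v \in S ->
    (0 < dot u (cross (z.2 - z.1) (v - z.1)) +
         e * dot x (cross (z.2 - z.1) (v - z.1))) =
    ((0 < dot u (cross (z.2 - z.1) (v - z.1))) ||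
    ((dot u (cross (z.2 - z.1) (v - z.1)) == 0) &&
     (0 < dot x (cross (z.2 - z.1) (v - z.1)))))).
  by apply: near0_all => z _; apply: near0_all => v _; exact: near0_sgn.
apply: near0_imp (near0_and N1 N2) => e e0 [h1 h2]; split.
  apply: generic_triples => // a b v aS bS vS ab va vb.
  by rewrite dotDl dotZl; apply: h1; exact: mem_triples.
move=> z zS; congr andb; apply: eq_in_all => v vS.
by rewrite dotDl dotZl h2.
Qed.

Lemma lsedgeP x a b : a != b -> reflect
  (forall v, v \in S -> v != a -> v != b ->
     0 < dot u (cross (b - a) (v - a)) \/
     dot u (cross (b - a) (v - a)) = 0 /\ 0 < dot x (cross (b - a) (v - a)))
  (lsedge x a b).
Proof.
move=> ab; rewrite /lsedge ab; apply: (iffP allP) => h v vS.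
  move=> /negPf va /negPf vb; have := h v vS; rewrite va vb /=.
  by case/orP=> [|/andP[/eqP]]; [left|right].
have [//|va] := eqVneq v a; have [//|vb] := eqVneq v b.
by have [->//|[-> ->]] := h v vS va vb; rewrite eqxx orbT.
Qed.

(** If both [x] and [- x] work, there are no ties to break: all the triple products with [u] are
    positive. *)
Lemma lsedge_both x x' a b : lsedge x a b -> lsedge (- x) a b -> lsedge x' a b.
Proof.
move=> h1 h2; have ab : a != b by case/andP: h1.
apply/lsedgeP => // v vS va vb; left.
have [//|[e h]] := lsedgeP x ab h1 v vS va vb.
have [//|[_]] := lsedgeP (- x) ab h2 v vS va vb.
by rewrite dotNl; lra.
Qed.

(** Every tie concerns a normal orthogonal to [u] and [b - a], hence a multiple of
    [cross u (b - a)]. The sign on this one vector breaks all ties, so [x'] or [- x'] breaks them as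
    [x] does. *)
Lemma lsedge_some x x' a b : a \in S -> b \in S -> cross u (b - a) != 0 ->
  gen x' -> lsedge x a b -> lsedge x' a b || lsedge (- x') a b.
Proof.
move=> aS bS n0 gx' h1; have ab : a != b by case/andP: h1.
have key x1 : gen x1 -> 0 <= dot x (cross u (b - a)) * dot x1 (cross u (b - a)) ->
    lsedge x1 a b.
  move=> gx1 hs; apply/lsedgeP => // v vS va vb.
  have [|[e h]] := lsedgeP x ab h1 v vS va vb; [by left|right; split=> //].
  have x1y := gx1 _ (mem_triples aS bS vS ab va vb) e.
  move: e h x1y; set y := cross (b - a) (v - a) => e h x1y.
  have [t et] : exists t, y = t *: cross u (b - a).
    by apply: orth_both => //; rewrite dotC// /y dot_crossl.
  rewrite lt_def x1y /=; move: h; rewrite et !dotZr; nra.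
have [h|h] := leP 0 (dot x (cross u (b - a)) * dot x' (cross u (b - a))).
  by rewrite key.
rewrite (key (- x')) ?orbT//; first exact: genN.
by rewrite dotNl mulrN oppr_ge0 ltW.
Qed.

(** By [lsedge_some] the sum is positive for all generic directions or for none; by [lsedge_both]
    the same holds for the value 2. *)
Lemma lsedge_sum x x' a b : a \in S -> b \in S -> cross u (b - a) != 0 ->
  gen x -> gen x' ->
  (lsedge x a b + lsedge (- x) a b = lsedge x' a b + lsedge (- x') a b)%N.
Proof.
move=> aS bS n0 gx gx'.
have s1 := lsedge_some aS bS n0 gx' (x := x).
have s2 := lsedge_some aS bS n0 gx' (x := - x).
have s3 := lsedge_some aS bS n0 gx (x := x').
have s4 := lsedge_some aS bS n0 gx (x := - x').
have b1 := @lsedge_both x x' a b; have b2 := @lsedge_both x (- x') a b.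
have b3 := @lsedge_both x' x a b; have b4 := @lsedge_both x' (- x) a b.
move: s1 s2 s3 s4 b1 b2 b3 b4.
case: (lsedge x a b); case: (lsedge (- x) a b);
  case: (lsedge x' a b); case: (lsedge (- x') a b) => //=;
  by do ?[move=> /(_ isT)//|move=> _].
Qed.

Lemma lsedge_par x a b : cross u (b - a) = 0 -> lsedge x a b = sedge S x a b.
Proof.
move=> /(cross_eq0 u0)[t e]; congr andb; apply: eq_all => v.
by rewrite e crossZl dotZr dot_crossl mulr0 ltxx eqxx.
Qed.

Lemma par_count_const k x x' : k_equiprojective P k -> edge_direction P u ->
  gen x -> gen x' -> par_count S u x = par_count S u x'.
Proof.
move=> Pk /(edge_direction_par eS nS)[a0 [b0 [aS0 bS0 p0 [m0 em0]]]].
have K y : gen y -> count (fun z => lsedge y z.1 z.2) (pairs S) = k.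
  move=> gy; have [e e0 [ge he]] := near0_ex (near0_lsedge gy).
  have d0 : u + e *: y != 0.
    apply: contra_neq (generic_edge eS nS ge aS0 bS0 em0) => ->.
    by rewrite cross0l.
  have := card_eq_uniq (card_extreme_proj uS eS nS d0 ge) (Pk _ d0 ge).
  by move=> <-; apply: eq_in_count => z zS; rewrite /= he.
pose par (z : vec * vec) := cross u (z.2 - z.1) == 0.
have Psplit y : gen y -> (par_count S u y + count (fun z =>
    lsedge y z.1 z.2 && ~~ par z) (pairs S))%N = k.
  move=> gy; rewrite -(K y gy) (count_split (fun z => lsedge y z.1 z.2) par).
  congr (_ + _)%N; apply: eq_count => z /=; rewrite [RHS]andbC /par.
  by case: eqP => [h|//]; rewrite (lsedge_par y h).
(* Evenness lets the total over [x] and [- x] determine [par_count]. *)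
have PN y : par_count S u (- y) = par_count S u y.
  by rewrite !(par_countE uS)// crossNl opprK addnC.
move=> gx gx'.
have := Psplit _ gx; have := Psplit _ (genN gx); have := Psplit _ gx'.
have := Psplit _ (genN gx'); rewrite !PN.
have : (count (fun z => lsedge x z.1 z.2 && ~~ par z) (pairs S) +
        count (fun z => lsedge (- x) z.1 z.2 && ~~ par z) (pairs S) =
        count (fun z => lsedge x' z.1 z.2 && ~~ par z) (pairs S) +
        count (fun z => lsedge (- x') z.1 z.2 && ~~ par z) (pairs S))%N.
  apply: count_sum_eq => -[a b]; rewrite mem_pairs => /andP[aS bS] /=.
  have [|np] := boolP (par (a, b)); first by rewrite !andbF.
  by rewrite !andbT; exact: lsedge_sum.
lia.
Qed.

Lemma cross_cross_unit m : dot m u = 0 -> cross (cross u m) u = m.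
Proof.
move=> mu; rewrite crossC cross_cross uu scale1r dotC mu scale0r sub0r opprK //.
Qed.

(** By [cross_cross_unit], the direction [cross u m] tests the normals [m] and [- m]. *)
Definition genm m := dot m u = 0 /\ gen (cross u m).

Lemma genmN m : genm m -> genm (- m).
Proof.
move=> [mu gm]; split; first by rewrite dotNl mu oppr0.
by rewrite crossNr; exact: genN.
Qed.

Lemma ex_genm : exists m, genm m.
Proof.
have [g hg] := ex_nonorthogonal triples_neq0.
exists (cross g u); split; first by rewrite dotC dot_crossr.
(* The vector [cross u (cross g u)] is [g] minus its component along [u], so both have the same
   product with [y]. *)
move=> y yY uy; rewrite cross_cross uu scale1r dotBl dotZl uy mulr0 subr0.
exact: hg.
Qed.

(** Generic normals are dense in the plane orthogonal to [u]. *)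
Lemma near0_genm w m : dot w u = 0 -> genm m -> near0 (fun e => genm (w + e *: m)).
Proof.
move=> wu [mu gm].
have N : near0 (fun e => forall y, y \in [seq y <- triples | dot u y == 0] ->
    dot (cross u w) y + e * dot (cross u m) y != 0).
  apply: near0_all => y; rewrite mem_filter => /andP[/eqP uy yY].
  by apply: near0_neq; rewrite (gm y)// orbT.
apply: near0_imp N => e _ h; split; first by rewrite dotDl dotZl wu mu mulr0 addr0.
move=> y yY uy; rewrite crossDr crossZr dotDl dotZl; apply: h.
by rewrite mem_filter uy eqxx.
Qed.

(** If [m] were maximal at [a], [b] and a third vertex [v], it would be a multiple of
    [cross (b - a) (v - a)], and [cross u m] would be orthogonal to that vector. *)
Lemma genm_strict m : genm m -> C m <-> strict_edge S u m.
Proof.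
move=> [mu gm]; split; last exact: strict_edge_agg.
apply: agg_strict_edge => // a b v aS bS vS ab va vb p hm mb mv.
have yY := mem_triples aS bS vS ab va vb.
have uy : dot u (cross (b - a) (v - a)) = 0.
  by have [t ->] := cross_eq0 u0 p; rewrite crossZl dotZr dot_crossl mulr0.
have /eqP := gm _ yY uy; apply.
have [t ->] : exists t, m = t *: cross (b - a) (v - a).
  by apply: orth_both (triples_neq0 yY); rewrite dotBr ?mb ?mv subrr.
by rewrite crossZr dotZl dotC dot_crossr mulr0.
Qed.

(** [C] is a finite union of closed cones, so its complement is open. *)
Lemma near0_not_agg w : dot w u = 0 -> ~ C w ->
  near0 (fun e => forall z, dot z z < e -> ~ C (w + z)).
Proof.
move=> wu nC.
have N : near0 (fun e => forall ab, ab \in pairs S -> forall z, dot z z < e ->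
    ~ (par_edge S u ab.1 ab.2 /\ edge_cone S ab.1 ab.2 (w + z))).
  apply: near0_all => -[a b] _ /=.
  have [pe|npe] := pselect (par_edge S u a b); last by exists 1 => // e _ z _ [].
  have [aS bS p _] := pe.
  have : ~ edge_cone S a b w.
    by move=> ew; apply: nC; apply/agg_coneP => //; exists a, b.
  move=> /not_andP[|/existsNP[x /not_implyP[xS /negP]]].
    by rewrite (par_dot p wu).
  rewrite -ltNge -subr_gt0 => h.
  apply: near0_imp (near0_ball (x - a) h) => e e0 he z /he hz [_ [_ /(_ x xS)]].
  by move: hz; rewrite !dotDl dotBr; lra.
apply: near0_imp N => e e0 h z ze /(agg_coneP eS nS _ u0)[a [b [pe ec]]].
have [aS bS _ _] := pe.
by apply: (h (a, b) _ z ze); rewrite ?mem_pairs ?aS.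
Qed.

Lemma par_edge_genm a b : par_edge S u a b ->
  exists2 m, genm m & edge_cone S a b m.
Proof.
move=> [aS bS p [m em]]; have [q gq] := ex_genm.
have [ab mb _ _] := edge_atP em.
have mu : dot m u = 0.
  have [t et] := cross_eq0 u0 p.
  have : dot m (b - a) = 0 by rewrite dotBr mb subrr.
  rewrite et dotZr => /eqP; rewrite mulf_eq0 => /orP[/eqP t0|/eqP//].
  by move: ab; rewrite eq_sym -subr_eq0 et t0 scale0r eqxx.
have qb : dot q b = dot q a by apply: par_dot => //; case: gq.
have [e e0 [ge he]] :=
  near0_ex (near0_and (near0_genm mu gq) (edge_cone_perturb em qb)).
by exists (m + e *: q).
Qed.

(** For generic [m], the number of elements of [C] among [m] and [- m] is constant, and it is at
    least 1 because of [m0]. Density of generic normals and openness of the complement of [C] carry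
    this to the whole plane. *)
Lemma equiprojective_cone k : k_equiprojective P k -> edge_direction P u ->
  C = perp u \/
  (C `&` relint (negset C) = set0 /\ C `|` relint (negset C) = perp u).
Proof.
move=> Pk du; have [a0 [b0 pe0]] := edge_direction_par eS nS du.
have [m0 gm0 ec0] := par_edge_genm pe0.
have sm0 : strict_edge S u m0.
  by apply/genm_strict => //; apply/agg_coneP => //; exists a0, b0.
have N m : genm m -> (strict_edge S u m + strict_edge S u (- m) =
    strict_edge S u m0 + strict_edge S u (- m0))%N.
  move=> gm; have [mu gx] := gm; have [m0u gx0] := gm0.
  have := par_count_const Pk du gx gx0.
  by rewrite !(par_countE uS)// !cross_cross_unit// addnC => ->; rewrite addnC.
have [q gq] := ex_genm.
have sub_perp : C `<=` perp u by move=> w /agg_perp.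
have [sNm0|sNm0] := boolP (strict_edge S u (- m0)).
  left; apply/seteqP; split=> // w wu; apply: contrapT => nC.
  have N1 := near0_line q (near0_not_agg wu nC).
  have [e e0 [nCe ge]] := near0_ex (near0_and N1 (near0_genm wu gq)).
  apply: nCe; apply/genm_strict => //; move: (N _ ge); rewrite sm0 sNm0.
  by case: strict_edge => //; case: strict_edge.
right; have N1 m : genm m -> (strict_edge S u m + strict_edge S u (- m) = 1)%N.
  by move=> /N ->; rewrite sm0 (negPf sNm0).
(* If both failed, a generic normal near [w] would give the sum 0. *)
have cov w : dot w u = 0 -> ~ C w -> C (- w).
  move=> wu nC; apply: contrapT => nC'.
  have wu' : dot (- w) u = 0 by rewrite dotNl wu oppr0.
  have M1 := near0_line q (near0_not_agg wu nC).
  have M2 := near0_line (- q) (near0_not_agg wu' nC').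
  have [e e0 [[c1 c2] ge]] :=
    near0_ex (near0_and (near0_and M1 M2) (near0_genm wu gq)).
  have := N1 _ ge.
  have [/(genm_strict ge)//|_] := boolP (strict_edge S u (w + e *: q)).
  have [/(genm_strict (genmN ge))|//] := boolP (strict_edge S u (- (w + e *: q))).
  by rewrite opprD -scalerN.
split.
  (* A common point [w], moved slightly inside its edge cone to a generic normal, would stay in [C]
     and in [- C], giving the sum 2. *)
  apply/seteqP; split=> // w [Cw [CNw [e1 [e10 h1]]]].
  have [a [b [pe ec]]] := (agg_coneP eS nS w u0).1 Cw.
  have [m gm ecm] := par_edge_genm pe.
  have Cm : C m by apply/agg_coneP => //; exists a, b.
  have C0 : C 0.
    by apply/agg_coneP => //; exists a, b; split=> //; split=> [|x _]; rewrite !dot0l.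
  have ball : near0 (fun e : R => forall z, dot z z < e -> dot z z < e1).
    by exists e1 => // e /andP[_ ee] z ze; exact: lt_trans ee.
  have M := near0_and (near0_line m ball) (near0_genm (agg_perp Cw) gm).
  have [e e0 [he ge]] := near0_ex M.
  have C1 : C (w + e *: m).
    apply/agg_coneP => //; exists a, b; split=> //.
    case: ec ecm => [wb hw] [mb hm]; split; first by rewrite !dotDl !dotZl wb mb.
    by move=> x xS; rewrite !dotDl !dotZl lerD ?hw// ler_wpM2l ?hm// ltW.
  have C2 : C (- (w + e *: m)).
    apply: h1; last by rewrite addrAC subrr add0r.
    (* An affine combination of three points of [- C]; the weights [e] and [- e] cancel. *)
    exists 3%N, (fun i : 'I_3 => nth 0 [:: w; 0; - m] i),
      (fun i : 'I_3 => nth 0 [:: 1; e; - e] i); split.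
      by move=> [[|[|[|//]]] hi]; rewrite /negset /= ?oppr0 ?opprK.
    split; rewrite !big_ord_recl big_ord0 /=; first by ring.
    by rewrite scale1r scaler0 add0r addr0 scaleNr scalerN opprK.
  have := N1 _ ge.
  by rewrite ((genm_strict ge).1 C1) ((genm_strict (genmN ge)).1 C2).
apply/seteqP; split=> [w [|[/agg_perp]]|w wu]; first exact: sub_perp.
  by rewrite /perp /= dotNl => h _; lra.
have [Cw|nC] := pselect (C w); [by left|right]; split; first exact: cov.
(* A ball around [w] avoids [C], so by [cov] its part in the plane lies in [- C]. *)
have [e e0 he] := near0_ex (near0_not_agg wu nC).
exists e; split=> // y /aff_agg_perp yu yw; apply: cov => //.
by have := he _ yw; rewrite addrC subrK.
Qed.

End Direction.

(** Pairs of vertices are grouped into classes of parallel pairs. A class with a silhouette edge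
    belongs to an edge direction, and [par_count_generic] gives it the same count for [d] and [d'];
    the other classes contribute 0. *)
Lemma cone_equiprojective :
  (forall u, edge_direction P u -> agg_cone P u = perp u \/
     (agg_cone P u `&` relint (negset (agg_cone P u)) = set0 /\
      agg_cone P u `|` relint (negset (agg_cone P u)) = perp u)) ->
  equiprojective P.
Proof.
move=> H.
have [[d [d0 gd]]|nex] := pselect (exists d, d != 0 /\ generic S d); last first.
  (* Without generic directions the condition is vacuous and any number serves. *)
  by exists 0%N => d d0 gd; exfalso; apply: nex; exists d.
exists (count (fun z => sedge S d z.1 z.2) (pairs S)) => d' d0' gd'.
suff -> : count (fun z => sedge S d z.1 z.2) (pairs S) =
          count (fun z => sedge S d' z.1 z.2) (pairs S).
  exact: card_extreme_proj.
(* Pairs with equal entries are dropped: the zero vector is parallel to everything and would destroy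
   transitivity. *)
pose Z := [seq z <- pairs S | z.1 != z.2].
have toZ d1 : count (fun z => sedge S d1 z.1 z.2) (pairs S) =
              count (fun z => sedge S d1 z.1 z.2) Z.
  rewrite count_filter; apply: eq_count => z /=.
  by have [/andP[->]|] := boolP (sedge _ _ _ _).
have nz (z : vec * vec) : z \in Z -> z.2 - z.1 != 0.
  by rewrite mem_filter subr_eq0 eq_sym => /andP[].
rewrite !toZ.
apply: (@count_classes _ (fun z z' => cross (z.2 - z.1) (z'.2 - z'.1) == 0)).
- by move=> z _; rewrite cross_self.
- by move=> x y z /nz x0 _ _ /eqP xy /eqP xz; rewrite (cross_trans x0 xy xz).
move=> x xZ.
have [|none] := boolP (has (fun z => (cross (x.2 - x.1) (z.2 - z.1) == 0) &&
    (sedge S d z.1 z.2 || sedge S d' z.1 z.2)) Z); last first.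
  rewrite (eq_in_count (a2 := pred0)) ?count_pred0.
    apply/esym; rewrite (eq_in_count (a2 := pred0)) ?count_pred0//.
    move=> z zZ; apply/negP => /andP[p e]; move/hasP: none; apply.
    by exists z; rewrite ?p ?e ?orbT.
  move=> z zZ; apply/negP => /andP[p e]; move/hasP: none; apply.
  by exists z; rewrite ?p ?e.
move=> /hasP[[a b] zZ /= /andP[/eqP p se]].
have [aS bS] : a \in S /\ b \in S.
  by move: zZ; rewrite mem_filter mem_pairs => /and3P[].
have [m em] : exists m, edge_at S m a b.
  have E d1 : sedge S d1 a b -> edge_at S (- cross d1 (b - a)) a b.
    by rewrite (@sedge_edge_at _ _ d1 (b - a) a b 1) ?scale1r.
  by case/orP: se => /E; eexists; eassumption.
have [u du up] := edge_has_direction eS aS bS em.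
have uu : dot u u = 1 by case: du.
have u0 : u != 0 by apply: contra_eq_neq uu => ->; rewrite dot0l eq_sym oner_neq0.
have l0 := nz _ zZ; rewrite /= in l0.
have parE z : (cross (x.2 - x.1) (z.2 - z.1) == 0) = (cross u (z.2 - z.1) == 0).
  have lx : cross (b - a) (x.2 - x.1) = 0 by rewrite crossC p oppr0.
  have lu : cross (b - a) u = 0 by rewrite crossC up oppr0.
  have xu : cross (x.2 - x.1) u = 0 by exact: cross_trans l0 lx lu.
  apply/eqP/eqP => h; first exact: cross_trans (nz _ xZ) xu h.
  by apply: (cross_trans u0) => //; rewrite crossC xu oppr0.
have cE d1 : count (fun z => (cross (x.2 - x.1) (z.2 - z.1) == 0) &&
    sedge S d1 z.1 z.2) Z = par_count S u d1.
  rewrite count_filter; apply: eq_count => z /=; rewrite parE.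
  by have [/andP[->]|] := boolP (sedge _ _ _ _); rewrite ?andbT ?andbF.
rewrite !cE.
have [h1 h2] := par_count_generic uu du gd.
have [h1' h2'] := par_count_generic uu du gd'.
by have [c|c] := H u du; [rewrite h1 ?h1'|rewrite h2 ?h2'].
Qed.

End Equiprojective.

Theorem theorem1p2 (R : realType) (P : set 'rV[R]_3) :
  polytope3 P ->
  (equiprojective P <->
   forall u : 'rV[R]_3, edge_direction P u ->
     agg_cone P u = perp u \/
     (agg_cone P u `&` relint (negset (agg_cone P u)) = set0 /\
      agg_cone P u `|` relint (negset (agg_cone P u)) = perp u)).
Proof.
move=> [[V ->]]; have [S [uS -> eS]] := vertex_list V => dim3.
(* Full-dimensionality enters in this form: no plane contains all vertices. *)
have nS n t : n != 0 -> exists2 x, x \in S & dot n x != t.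
  move=> n0; apply: contrapT => h; apply: (dim_ge3_nonplanar dim3 n0 (t := t)).
  apply: (conv_min (@plane_cvx _ n t)) => x xS /=.
  by apply/eqP; apply: contrapT => /negP ne; apply: h; exists x.
split=> [[k Pk] u du|]; last exact: cone_equiprojective.
by apply: (equiprojective_cone uS eS nS _ Pk du); case: du.
Qed.
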